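(* Fix $0<\eta<1/2$. There exist some $c>0$ in the model selection prior $\lambda_n(m)\propto\exp(-c\,m\log(en))$, $m\in\mathbb N$, and constants $C_1,C_2>0$, all depending only on $\eta$, such that if $$\tau_{m,g}^{\mathrm{iso}}\ge e^{-\log(en)/(2\eta)},$$ then $$P_{f_0}^{(n)}\Pi_n\big(f\in\mathcal F:\ell_n^2(f,f_0)>C_1(\epsilon_{n,m}^{\mathrm{iso}})^2\,\big|\,Y^{(n)}\big)\le C_2e^{-n(\epsilon_{n,m}^{\mathrm{iso}})^2/C_2},$$ where $$(\epsilon_{n,m}^{\mathrm{iso}})^2\equiv\max\Big\{\inf_{g\in\mathcal F_m}\ell_n^2(f_0,g),\ \frac{m\log(en)}{n}\Big\}.$$
   Context: Model: $Y_i=f_0(x_i)+\varepsilon_i$, $1\le i\le n$, with $x_i=i/(n+1)$, $\varepsilon_i$ i.i.d. $\mathcal N(0,1)$, $Y^{(n)}=(Y_1,\dots,Y_n)$; $P_{f_0}^{(n)}$ is expectation under $f_0:[0,1]\to\mathbb R$. $\ell_n^2(f,g)=n^{-1}\sum_{i=1}^n(f(x_i)-g(x_i))^2$. $\mathcal F=\{f:[0,1]\to\mathbb R: f\text{ non-decreasing}\}$ and $\mathcal F_m=\{f\in\mathcal F:f\text{ piecewise constant with at most }m\text{ constant pieces}\}$. Prior: $g$ is a probability density on $\mathbb R$, symmetric about $0$ and non-increasing on $(0,\infty)$; $\bar g_m(\boldsymbol\mu)=m!\prod_{k=1}^mg(\mu_k)\mathbf 1_{\{\mu_1\le\dots\le\mu_m\}}$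 is a density on $\{\mu_1\le\dots\le\mu_m\}\subset\mathbb R^m$. First draw $m$ from $\lambda_n$; given $m$, pick (uniformly) at random a set of change points $\{x_{i(k)}\}_{k=1}^m$, $i(1)<\dots<i(m)$, i.e. a partition of the design points into $m$ consecutive blocks, and put the prior $\bar g_m$ on the values $(f(x_{i(k)}))_{k=1}^m$ of $f$ on the corresponding $m$ constant pieces (for $m>n$, use the model and prior of index $n$). $\Pi_n(\cdot\mid Y^{(n)})$ is the resulting posterior. $\tau_{m,g}^{\mathrm{iso}}=\sup_{f_{0,m}}g(\|f_{0,m}\|_\infty+1)$, the supremum being over $f_{0,m}\in\arg\min_{h\in\mathcal F_m}\ell_n^2(f_0,h)$, where the values of $f_{0,m}$ outside $[1/(n+1),n/(n+1)]$ are defined by extending $f_{0,m}(1/(n+1))$ and $f_{0,m}(n/(n+1))$ constantly towards the endpoints. *)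

(* Defs.v *)
From HB Require Import structures.
From mathcomp Require Import all_boot all_order all_algebra.
From mathcomp Require Import all_classical all_reals all_analysis.

Set Implicit Arguments.
Unset Strict Implicit.
Unset Printing Implicit Defensive.

Import Order.TTheory GRing.Theory Num.Theory.
Import numFieldNormedType.Exports.

Local Open Scope classical_set_scope.
Local Open Scope ring_scope.

Section tuple_cons_measure.
Context d (T : measurableType d) (R : realType) (n : nat).
Variables (m1 : {sigma_finite_measure set T -> \bar R})
          (m2 : {sigma_finite_measure set (n.-tuple T) -> \bar R}).

Definition cons_pair (p : T * n.-tuple T) : n.+1.-tuple T :=
  [tuple of p.1 :: p.2].

Lemma measurable_cons_pair : measurable_fun setT cons_pair.
Proof. exact: measurable_cons. Qed.

Definition cons_measure : set (n.+1.-tuple T) -> \bar R :=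
  pushforward (m1 \x m2)%E cons_pair.

Let cons_measure0 : cons_measure set0 = 0%E.
Proof. by rewrite /cons_measure /pushforward preimage_set0 measure0. Qed.

Let cons_measure_ge0 A : (0 <= cons_measure A)%E.
Proof. by rewrite /cons_measure /pushforward measure_ge0. Qed.

Let cons_measure_sigma_additive : semi_sigma_additive cons_measure.
Proof.
move=> F mF tF mUF; rewrite /cons_measure /pushforward preimage_bigcup.
have mC A : measurable A -> measurable (cons_pair @^-1` A).
  by move=> mA; rewrite -[X in measurable X]setTI; exact: measurable_cons_pair.
apply: measure_semi_sigma_additive.
- by move=> k; exact: mC.
- apply/trivIsetP => i j _ _ ij; rewrite -preimage_setI.
  by move/trivIsetP : tF => /(_ _ _ _ _ ij) ->//; rewrite preimage_set0.
- by rewrite -preimage_bigcup; exact: mC.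
Qed.

HB.instance Definition _ := isMeasure.Build _ _ _ cons_measure
  cons_measure0 cons_measure_ge0 cons_measure_sigma_additive.

Lemma cons_measure_sigma_finite : sigma_finite setT cons_measure.
Proof.
have /sigma_finiteP[F [UF ndF Foo]] := sigma_finiteT m1.
have /sigma_finiteP[G [UG ndG Goo]] := sigma_finiteT m2.
pose h (t : n.+1.-tuple T) : T * n.-tuple T := (thead t, [tuple of behead t]).
have mh : measurable_fun setT h.
  by apply/measurable_fun_pair; [exact: measurable_tnth|
    exact: measurable_behead].
have ch : cancel cons_pair h by move=> [x t]; congr (_, _); exact/val_inj.
have UFG : \bigcup_k (F k `*` G k) = setT.
  rewrite -subTset => -[x y] _.
  have [i _ Fx] : (\bigcup_k F k) x by rewrite -UF.
  have [j _ Gy] : (\bigcup_k G k) y by rewrite -UG.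
  exists (maxn i j) => //; split.
  - by move: x Fx; exact/subsetPset/ndF/leq_maxl.
  - by move: y Gy; exact/subsetPset/ndG/leq_maxr.
exists (fun k => h @^-1` (F k `*` G k)).
  by rewrite -preimage_bigcup UFG preimage_setT.
move=> k; have [mFk Fk] := Foo k; have [mGk Gk] := Goo k; split.
  by rewrite -[X in measurable X]setTI; apply: mh => //; exact: measurableX.
rewrite /cons_measure /pushforward -comp_preimage.
rewrite (_ : h \o cons_pair = id); last by apply/funext => p /=; rewrite ch.
by rewrite preimage_id product_measure1E// lte_mul_pinfty// ge0_fin_numE.
Qed.

HB.instance Definition _ :=
  @Measure_isSigmaFinite.Build _ _ _ cons_measure cons_measure_sigma_finite.

End tuple_cons_measure.

(* The product measure mu_0 (x) ... (x) mu_(n-1) on n.-tuple T. *)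
Fixpoint tuple_measure d (T : measurableType d) (R : realType) (n : nat) :
    ('I_n -> {sigma_finite_measure set T -> \bar R}) ->
    {sigma_finite_measure set (n.-tuple T) -> \bar R} :=
  match n with
  | 0 => fun=> \d_([tuple] : 0.-tuple T)
  | k.+1 => fun mu =>
      cons_measure (mu ord0) (tuple_measure (fun i => mu (lift ord0 i)))
  end.

Section isotonic_regression.
Context (R : realType).
Implicit Types (f : R -> R) (n m : nat).

(* Functions on [0, 1] are represented by functions on R of which only the
   values on [0, 1] are constrained or used. *)

Definition design n (i : 'I_n) : R := i.+1%:R / n.+1%:R.

Definition sqloss n f (f0 : R -> R) : R :=
  n%:R^-1 * \sum_(i < n) (f (design i) - f0 (design i)) ^+ 2.

Definition supnorm f : R := sup [set `|f x| | x in `[0, 1]].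

Definition iso : set (R -> R) :=
  [set f | {in `[0, 1] &, {homo f : x y / x <= y}}].

(* The intervals may be empty, hence "at most" m pieces. *)
Definition iso_pieces m : set (R -> R) :=
  [set f | iso f /\ exists I : 'I_m -> interval R,
    [/\ \bigcup_k [set` I k] = `[0, 1]%classic,
        trivIset setT (fun k => [set` I k]) &
        forall k, {in I k &, forall x y, f x = f y}]].

Definition constant_ends n f : Prop :=
  (forall x, 0 <= x <= 1 / n.+1%:R -> f x = f (1 / n.+1%:R)) /\
  (forall x, n%:R / n.+1%:R <= x <= 1 -> f x = f (n%:R / n.+1%:R)).

Definition best_approx n m (f0 : R -> R) : set (R -> R) :=
  [set f | [/\ iso_pieces m f, constant_ends n f &
    forall h, iso_pieces m h -> sqloss n f0 f <= sqloss n f0 h]].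

Definition tau_iso n m (g : R -> R) (f0 : R -> R) : R :=
  sup [set g (supnorm f + 1) | f in best_approx n m f0].

Definition log_en n : R := ln (expR 1 * n%:R).

Definition eps2_iso n m (f0 : R -> R) : R :=
  Num.max (inf [set sqloss n f0 h | h in iso_pieces m])
          (m%:R * log_en n / n%:R).

Definition prior_density (g : R -> R) : Prop :=
  [/\ measurable_fun setT g,
      (forall x, 0 <= g x) /\ (\int[lebesgue_measure]_x (g x)%:E = 1)%E,
      forall x, g (- x) = g x &
      forall x y, 0 < x -> x <= y -> g y <= g x].

Definition ordered_density (g : R -> R) m (mu : m.-tuple R) : R :=
  if sorted <=%R mu then m`!%:R * \prod_(k < m) g (tnth mu k) else 0.

(* A partition of the n design points into m consecutive nonempty blocks is
   encoded by the set of the first indices of its blocks; thus index 0 always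
   belongs to it. *)
Definition change_points n m : {pred {set 'I_n}} :=
  [pred S : {set 'I_n} |
    (#|S| == m) && [forall i : 'I_n, (val i == 0%N) ==> (i \in S)]].

Arguments change_points : clear implicits.

(* The right-continuous step function with value mu_k on the k-th block: the
   index of the block of x is the number of block starts in (-oo, x], minus 1.
   The first value extends to the left of the first design point. *)
Definition step n (S : {set 'I_n}) m (mu : m.-tuple R) : R -> R :=
  fun x => nth 0 mu (#|[pred j in S | design j <= x]|.-1).

Definition lambda (c : R) n m : \bar R :=
  let w k := (expR (- (c * k%:R * log_en n)))%:E in
  (w m / \sum_(1 <= k <oo) w k)%E.

Definition lebesgue_tuple m := tuple_measure (fun _ : 'I_m =>
  (lebesgue_measure : {sigma_finite_measure set (measurableTypeR R) -> \bar R})).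

(* The prior expectation of H(f) given model m, for 1 <= m <= n. *)
Definition model_integral n m (g : R -> R) (H : (R -> R) -> \bar R) : \bar R :=
  ((#|change_points n m|%:R^-1)%:E *
   \sum_(S in change_points n m)
     \int[lebesgue_tuple m]_mu ((ordered_density g mu)%:E * H (step S mu)))%E.

(* The prior expectation of H(f); a model index m > n stands for model n. *)
Definition prior_integral c n (g : R -> R) (H : (R -> R) -> \bar R) : \bar R :=
  (\sum_(1 <= m <oo) lambda c n m * model_integral n (minn m n) g H)%E.

Definition likelihood n (Y : n.-tuple R) f : R :=
  \prod_(i < n) normal_pdf (f (design i)) 1 (tnth Y i).

Definition posterior c n g (Y : n.-tuple R) (A : set (R -> R)) : \bar R :=
  (prior_integral c n g (fun f => (\1_A f * likelihood Y f)%:E) /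
   prior_integral c n g (fun f => (likelihood Y f)%:E))%E.

Definition data_law n (f0 : R -> R) := tuple_measure (fun i : 'I_n =>
  (normal_prob (f0 (design i)) 1
    : {sigma_finite_measure set (measurableTypeR R) -> \bar R})).

End isotonic_regression.

(* Main.v *)
Require Import Defs.
From HB Require Import structures.
From mathcomp Require Import all_boot all_order all_algebra.
From mathcomp Require Import all_classical all_reals all_analysis.
From mathcomp Require Import measurable_realfun zify.
From Stdlib Require Import Field.

(**
Write [e_i = Y_i - f0 (x_i)] for the noise, [v_i = f (x_i) - f0 (x_i)],
[L = log (en)] and [E = n eps^2], so that [m L <= E].  The likelihood ratio of
[f] against [f0] is [exp (<e, v> - |v|^2 / 2)], and the posterior probability
of [A = {|v|^2 > C1 E}] is a quotient [N / Z] of prior integrals of likelihood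
ratios.  Both are compared with random variables of controlled expectation.

Numerator.  The step functions with a given set [S] of block starts form a
linear space of dimension [|S|].  On this space [<e, v>] is at most a multiple
of the squared norm of the projection of [e], plus a single Gaussian variable,
plus a small multiple of [|v|^2].  The squared norm of the projection is a
chi-square variable, so that a small power of the likelihood ratio times
[exp (|v|^2 / 8)] is bounded, uniformly over the step functions on [S], by a
variable [U_S] of expectation at most [e 2^|S|] ([block_likelihood_bound],
[step_likelihood_bounds]).  These bounds play the part of tests, and the union
bound over [S] that of a sieve.  If every [U_S] is below
[exp (2 (|S| L + E))], the likelihood ratio is at most
[exp (K |S| L + K E - C1 E / 8)] on [A], and the weight [exp (- c k L)] of the
models with [k] pieces absorbs [exp (K k L)] and the factorial of the ordered
densities ([prior_integral_le], [numerator_le]).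

Denominator.  A best approximation of [f0] with [m] pieces is, on the design
points, a step function with exactly [min (m, n)] blocks ([monotone_step],
[oracle_step]).  The prior gives a box of side of order [n^-2] next to it a
mass of at least [exp (- const m L)]; the condition on [tau] enters here
([model_integral_ge], [oracle_mass_ge]).  On this box the inverse of the
likelihood ratio is bounded by one variable [V] of expectation at most
[2 exp (2 E + 2)] ([inverse_likelihood_bound]).

Conclusion.  As [N / Z <= 1] always, and [N / Z <= exp (- E)] when [V] and all
[U_S] are below their thresholds, Markov's inequality takes the pointwise form
[N / Z <= V exp (- 3 E) + sum_S U_S exp (- 2 (|S| L + E)) + exp (- E)], which
is integrated term by term ([expected_posterior_le]).
*)

Set Implicit Arguments.
Unset Strict Implicit.
Unset Printing Implicit Defensive.

Import Order.TTheory GRing.Theory Num.Theory.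
Local Open Scope classical_set_scope.
Local Open Scope ring_scope.

(** * Field identities over a real type *)

Section real_operations.
Context (R : realType).

(** Names for the field operations: the reifier of [field] compares operators
syntactically, while the same operation of [R] is reached through several
paths of canonical structures. *)
Definition real_add (x y : R) : R := x + y.
Definition real_mul (x y : R) : R := x * y.
Definition real_sub (x y : R) : R := x - y.
Definition real_opp (x : R) : R := - x.
Definition real_inv (x : R) : R := x^-1.
Definition real_div (x y : R) : R := x / y.
Definition real_zero : R := 0.
Definition real_one : R := 1.

Lemma real_field_theory :
  field_theory real_zero real_one real_add real_mul real_sub real_opp
    real_div real_inv eq.
Proof.
split; [split| | |].
- exact: add0r.
- exact: addrC.
- exact: addrA.
- exact: mul1r.
- exact: mulrC.
- exact: mulrA.
- exact: mulrDl.
- by [].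
- exact: subrr.
- by apply/eqP; exact: oner_neq0.
- by [].
- by move=> x /eqP x0; exact: mulVf.
Qed.

End real_operations.
#[global] Arguments real_add : simpl never.
#[global] Arguments real_mul : simpl never.
#[global] Arguments real_sub : simpl never.
#[global] Arguments real_opp : simpl never.
#[global] Arguments real_inv : simpl never.
#[global] Arguments real_div : simpl never.
#[global] Arguments real_zero : simpl never.
#[global] Arguments real_one : simpl never.

(** Powers and multiples with literal exponents are unfolded, which is how the
numerals become sums of ones. *)
Ltac real_fold R t :=
  lazymatch t with
  | @GRing.add _ ?a (@GRing.opp _ ?b) =>
      let a := real_fold R a in let b := real_fold R b in
      constr:(@real_sub R a b)
  | @GRing.add _ ?a ?b =>
      let a := real_fold R a in let b := real_fold R b in
      constr:(@real_add R a b)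
  | @GRing.mul _ ?a (@GRing.inv _ ?b) =>
      let a := real_fold R a in let b := real_fold R b in
      constr:(@real_div R a b)
  | @GRing.mul _ ?a ?b =>
      let a := real_fold R a in let b := real_fold R b in
      constr:(@real_mul R a b)
  | @GRing.opp _ ?a => let a := real_fold R a in constr:(@real_opp R a)
  | @GRing.inv _ ?a => let a := real_fold R a in constr:(@real_inv R a)
  | @GRing.exp _ _ O => constr:(@real_one R)
  | @GRing.exp _ ?a 1%N => real_fold R a
  | @GRing.exp _ ?a (S ?n) =>
      let b := real_fold R (@GRing.exp R a n) in
      let a := real_fold R a in
      constr:(@real_mul R a b)
  | @GRing.natmul _ _ O => constr:(@real_zero R)
  | @GRing.natmul _ ?a 1%N => real_fold R a
  | @GRing.natmul _ ?a (S ?n) =>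
      let b := real_fold R (@GRing.natmul R a n) in
      let a := real_fold R a in
      constr:(@real_add R a b)
  | @GRing.zero _ => constr:(@real_zero R)
  | @GRing.one _ => constr:(@real_one R)
  | ?x => constr:(x : R)
  end.

Ltac real_field_of R :=
  lazymatch goal with
  | |- @eq _ ?a ?b =>
    let a := real_fold R a in let b := real_fold R b in
    change (@eq (Real.sort R) a b)
  end.

Ltac real_nonzero :=
  apply/eqP; first [assumption | apply/lt0r_neq0;
    first [assumption |
      repeat (first [exact: ltr01 | apply: addr_gt0 | apply: mulr_gt0])]].

Ltac real_field :=
  lazymatch goal with
  | R : realType |- _ => real_field_of R; field; repeat split; real_nonzero
  end.

(** * Integration against products of measures *)

Section integration.
Local Open Scope ereal_scope.

(** The integral of a nonnegative function is a supremum over simple functions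
below it, which is monotone without measurability.  The integrands it is applied to,
such as the posterior, are bounded by measurable functions but are not shown to
be measurable themselves. *)
Lemma ge0_le_integral_nonmeasurable d (T : measurableType d) (R : realType)
    (mu : {measure set T -> \bar R}) (f1 f2 : T -> \bar R) :
  (forall x, 0 <= f1 x) -> (forall x, f1 x <= f2 x) ->
  \int[mu]_x f1 x <= \int[mu]_x f2 x.
Proof.
move=> f10 f12.
have f20 x : 0 <= f2 x by exact: le_trans (f12 x).
rewrite !ge0_integralTE//; apply: le_ereal_sup => _ [h hf1 <-].
by exists h => // x; exact: le_trans (f12 x).
Qed.

(** Tonelli's theorem for one coordinate. *)
Lemma integral_tuple_measure_cons d (T : measurableType d) (R : realType)
    (n : nat) (mu : 'I_n.+1 -> {sigma_finite_measure set T -> \bar R})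
    (f : n.+1.-tuple T -> \bar R) :
  measurable_fun [set: n.+1.-tuple T] f -> (forall t, 0 <= f t) ->
  \int[tuple_measure mu]_t f t =
  \int[mu ord0]_x \int[tuple_measure (fun i => mu (lift ord0 i))]_t
     f (cons_tuple x t).
Proof.
move=> mf f0.
set m2 := tuple_measure (fun i => mu (lift ord0 i)).
have mc := @measurable_cons_pair _ T n.
transitivity (\int[pushforward (mu ord0 \x m2) (@cons_pair _ T n)]_t f t).
  by [].
rewrite ge0_integral_pushforward// preimage_setT fubini_tonelli1//.
- by apply: measurableT_comp; [exact: mf|exact: mc].
- by move=> x; exact: f0.
Qed.

Lemma integral_tuple_measure_prod d (T : measurableType d) (R : realType)
    (n : nat) (mu : 'I_n -> {sigma_finite_measure set T -> \bar R})
    (f : 'I_n -> T -> R) (c : 'I_n -> R) :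
  (forall i, measurable_fun setT (f i)) -> (forall i x, (0 <= f i x)%R) ->
  (forall i, \int[mu i]_x (f i x)%:E = (c i)%:E) ->
  \int[tuple_measure mu]_t (\prod_(i < n) f i (tnth t i))%:E =
  (\prod_(i < n) c i)%:E.
Proof.
elim: n mu f c => [|n IH] mu f c mf f0 fc.
  rewrite [LHS](_ : _ = \int[\d_([tuple] : 0.-tuple T)]_t 1); last first.
    by apply: eq_integral => t _; rewrite big_ord0.
  by rewrite integral_cst//= mul1e big_ord0 diracT.
have mp k (g : 'I_k -> T -> R) : (forall i, measurable_fun setT (g i)) ->
    measurable_fun [set: k.-tuple T] (fun t => \prod_(i < k) g i (tnth t i))%R.
  move=> mg; apply: measurable_prod => i _.
  by apply: (measurableT_comp (mg i)); exact: measurable_tnth.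
rewrite integral_tuple_measure_cons; last 2 first.
- by apply/measurable_EFinP; exact: mp.
- by move=> t; rewrite lee_fin prodr_ge0.
under eq_integral => x _.
  under eq_integral => t _.
    rewrite big_ord_recl tnth0 EFinM.
    rewrite (_ : (\prod_(i < n) _)%R =
      (\prod_(i < n) f (lift ord0 i) (tnth t i))%R); last first.
      by apply: eq_bigr => i _; rewrite tnthS.
    over.
  rewrite ge0_integralZl//=; last 3 first.
  - by apply/measurable_EFinP; apply: (mp n (fun i => f (lift ord0 i))).
  - by move=> t _; rewrite lee_fin prodr_ge0.
  - by rewrite lee_fin.
  rewrite (IH _ (fun i => f (lift ord0 i)) (fun i => c (lift ord0 i)))//.
  rewrite muleC.
  over.
have c0 i : (0 <= c i)%R.
  by rewrite -lee_fin -fc integral_ge0// => x _; rewrite lee_fin.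
rewrite ge0_integralZl//; last 3 first.
- by apply/measurable_EFinP.
- by move=> x _; rewrite lee_fin.
- by rewrite lee_fin prodr_ge0.
by rewrite fc big_ord_recl mulrC EFinM.
Qed.

End integration.

(** * Exponential moments of Gaussian vectors *)

Section gaussian.
Context (R : realType).
Add Field real_field : (real_field_theory R).
Local Open Scope ereal_scope.
Local Notation leb := (@lebesgue_measure R).

(** The density of the normal law is its Radon-Nikodym derivative up to a null
set, since both have the same integral over each measurable set. *)
Lemma integral_normal_prob (mu s : R) (f : R -> R) :
  measurable_fun setT f -> (forall x, (0 <= f x)%R) ->
  \int[normal_prob mu s]_x (f x)%:E =
  \int[leb]_x (f x * normal_pdf mu s x)%:E.
Proof.
move=> mf f0.
pose nu := [the {finite_measure set _ -> \bar R} of normal_prob mu s].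
have dom : nu `<< leb by exact: normal_prob_dominates.
pose rn := Radon_Nikodym_SigmaFinite.f nu leb.
transitivity (\int[leb]_x ((f x)%:E * rn x)).
  apply/esym/Radon_Nikodym_SigmaFinite.change_of_variables => //.
  by apply/measurable_EFinP.
have mpdf : measurable_fun setT (fun x => (normal_pdf mu s x)%:E).
  by apply/measurable_EFinP; exact: measurable_normal_pdf.
have irn := Radon_Nikodym_SigmaFinite.f_integrable dom.
have mrn : measurable_fun setT rn by exact: (measurable_int _ irn).
under [RHS]eq_integral do rewrite EFinM.
apply: ge0_ae_eq_integral => //.
- by apply: emeasurable_funM => //; apply/measurable_EFinP.
- by apply: emeasurable_funM => //; apply/measurable_EFinP.
- move=> x _; rewrite mule_ge0 ?lee_fin//.
  exact: Radon_Nikodym_SigmaFinite.f_ge0.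
- by move=> x _; rewrite mule_ge0 ?lee_fin// normal_pdf_ge0.
- apply: ae_eqe_mul2l; apply: integral_ae_eq => //.
  by move=> E _ mE; rewrite -Radon_Nikodym_SigmaFinite.f_integral.
Qed.

Let normal_pdf_expR (mu s x : R) : s != 0%R ->
  normal_pdf mu s x =
  (normal_peak s * expR (- (x - mu) ^+ 2 / (s ^+ 2 *+ 2)))%R.
Proof. by move=> s0; rewrite /normal_pdf (negbTE s0). Qed.

Lemma normal_pdf1E (mu x : R) :
  normal_pdf mu 1 x = (normal_pdf 0 1 0 * expR (- (x - mu) ^+ 2 / 2))%R.
Proof.
rewrite !normal_pdf_expR ?oner_neq0// !subr0 expr1n.
by rewrite expr0n/= oppr0 mul0r expR0 mulr1.
Qed.

(** Completing the square turns the integrand into a multiple of the normal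
density of mean [mu + t]. *)
Lemma integral_normal_expR (mu t : R) :
  \int[normal_prob mu 1]_x (expR (t * (x - mu)))%:E = (expR (t ^+ 2 / 2))%:E.
Proof.
have mE : measurable_fun setT (fun x : R => expR (t * (x - mu))).
  by apply: measurableT_comp => //; apply: measurable_funM => //;
    exact: measurable_funB.
rewrite integral_normal_prob//.
transitivity (\int[leb]_x ((expR (t ^+ 2 / 2))%:E *
                            (normal_pdf (mu + t) 1 x)%:E)).
  apply: eq_integral => x _; rewrite -EFinM; congr (_%:E).
  rewrite !(normal_pdf1E _ x) !(mulrCA _ (normal_pdf _ _ _)) -!expRD.
  by congr (_ * expR _)%R; real_field.
rewrite ge0_integralZl//; last 2 first.
- by apply/measurable_EFinP; exact: measurable_normal_pdf.
- by move=> x _; rewrite lee_fin normal_pdf_ge0.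
by rewrite integral_normal_pdf mule1.
Qed.

(** [3 x^2 / 8 - x^2 / 2 = - x^2 / 8] is the exponent of the normal density of
standard deviation 2, whose peak is half of the standard one. *)
Lemma integral_normal_expR_sqr :
  \int[normal_prob 0 1]_x (expR (3 / 8 * x ^+ 2))%:E = (2 : R)%:E.
Proof.
have mE : measurable_fun setT (fun x : R => expR (3 / 8 * x ^+ 2)).
  by apply: measurableT_comp => //; apply: measurable_funM => //;
    exact: measurable_funX.
rewrite integral_normal_prob//.
transitivity (\int[leb]_x ((2 : R)%:E * (normal_pdf 0 2 x)%:E)).
  apply: eq_integral => x _; rewrite -EFinM; congr (_%:E).
  rewrite !normal_pdf_expR// /normal_peak.
  rewrite (_ : (2 ^+ 2 * pi *+ 2 = 2 ^+ 2 * (1 ^+ 2 * pi *+ 2) :> R)%R); last first.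
    by rewrite expr1n mul1r mulrnAr.
  rewrite sqrtrM ?sqr_ge0// sqrtr_sqr ger0_norm// invfM.
  rewrite mulrCA -expRD !mulrA divff ?mul1r//.
  by congr (_ * expR _)%R; real_field.
rewrite ge0_integralZl//; last 2 first.
- by apply/measurable_EFinP; exact: measurable_normal_pdf.
- by move=> x _; rewrite lee_fin normal_pdf_ge0.
by rewrite integral_normal_pdf mule1.
Qed.

End gaussian.

Section gaussian_vectors.
Context (R : realType).
Add Field real_field : (real_field_theory R).
Local Open Scope ereal_scope.

Definition gaussian n (a : 'I_n -> R) := tuple_measure (fun i : 'I_n =>
  (normal_prob (a i) 1
    : {sigma_finite_measure set (measurableTypeR R) -> \bar R})).

Lemma gaussian_expR n (a u : 'I_n -> R) :
  \int[gaussian a]_Y (expR (\sum_(i < n) u i * (tnth Y i - a i)))%:E =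
  (expR (\sum_(i < n) u i ^+ 2 / 2))%:E.
Proof.
under eq_integral do rewrite expR_sum.
rewrite expR_sum.
apply: (@integral_tuple_measure_prod _ (measurableTypeR R) R n _
  (fun i x => expR (u i * (x - a i))%R)
  (fun i => expR (u i ^+ 2 / 2))) => [i|i x|i].
- apply: measurableT_comp => //; apply: measurable_funM => //.
  exact: measurable_funB.
- exact: expR_ge0.
- exact: integral_normal_expR.
Qed.

Lemma standard_gaussian_expR_sqr n :
  \int[gaussian (fun _ : 'I_n => 0%R)]_z
    (expR (\sum_(b < n) 3 / 8 * tnth z b ^+ 2))%:E = ((2 : R) ^+ n)%:E.
Proof.
under eq_integral do rewrite expR_sum.
rewrite -[in RHS](card_ord n) -prodr_const.
apply: (@integral_tuple_measure_prod _ (measurableTypeR R) R n _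
  (fun _ x => expR (3 / 8 * x ^+ 2)%R) (fun=> 2%R)) => [i|i x|i].
- by apply: measurableT_comp => //; apply: measurable_funM.
- exact: expR_ge0.
- exact: integral_normal_expR_sqr.
Qed.

Lemma measurable_linear_form n (T := measurableTypeR R) (u a : 'I_n -> R) :
  measurable_fun [set: n.-tuple T]
    (fun Y => \sum_(i < n) u i * (tnth Y i - a i))%R.
Proof.
apply: measurable_sum => i; apply: measurable_funM => //.
by apply: measurable_funB => //; exact: measurable_tnth.
Qed.

(** The Hubbard-Stratonovich linearisation: the exponential of a square is a
Gaussian mixture of exponentials of linear forms. *)
Lemma hubbard_stratonovich n d (q : 'I_d -> 'I_n -> R) (w e : 'I_n -> R) :
  \int[gaussian (fun _ : 'I_d => 0%R)]_z
    (expR (\sum_(i < n) (\sum_(b < d) tnth z b * q b i + w i) * e i))%:E =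
  (expR (\sum_(i < n) w i * e i +
         \sum_(b < d) (\sum_(i < n) q b i * e i) ^+ 2 / 2))%:E.
Proof.
pose t b : R := (\sum_(i < n) q b i * e i)%R.
rewrite expRD EFinM -(gaussian_expR (fun=> 0%R) t).
rewrite -ge0_integralZl ?lee_fin ?expR_ge0//; last first.
  apply/measurable_EFinP; apply: measurableT_comp => //.
  exact: measurable_linear_form.
apply: eq_integral => z _; rewrite -EFinM -expRD; congr (expR _)%:E.
under eq_bigr do rewrite mulrDl.
rewrite big_split/= addrC; congr (_ + _)%R.
under eq_bigr do rewrite mulr_suml.
rewrite exchange_big/=; apply: eq_bigr => b _; rewrite subr0 mulr_suml.
by apply: eq_bigr => i _; rewrite -mulrA mulrC.
Qed.

(** After linearisation the two Gaussian integrals are exchanged.  An exponential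
moment of a quadratic form of rank [d] in [n] variables becomes an integral over
[d] variables, as it would after a rotation. *)
Lemma gaussian_expR_quadratic n d (a w : 'I_n -> R) (q : 'I_d -> 'I_n -> R) :
  \int[gaussian a]_Y
    (expR (\sum_(i < n) w i * (tnth Y i - a i) +
      \sum_(b < d) (\sum_(i < n) q b i * (tnth Y i - a i)) ^+ 2 / 2))%:E =
  \int[gaussian (fun _ : 'I_d => 0%R)]_z
    (expR (\sum_(i < n) (\sum_(b < d) tnth z b * q b i + w i) ^+ 2 / 2))%:E.
Proof.
under eq_integral do rewrite -hubbard_stratonovich.
under [RHS]eq_integral do rewrite -(gaussian_expR a).
pose F (p : n.-tuple (measurableTypeR R) * d.-tuple (measurableTypeR R)) :=
  (expR (\sum_(i < n) (\sum_(b < d) tnth p.2 b * q b i + w i) *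
                      (tnth p.1 i - a i)))%:E.
apply: (@fubini_tonelli _ _ _ _ R (gaussian a) (gaussian (fun=> 0%R)) F)
  => [|p]; last by rewrite lee_fin expR_ge0.
apply/measurable_EFinP; apply: measurableT_comp => //.
apply: measurable_sum => i; apply: measurable_funM.
- apply: measurable_funD => //; apply: measurable_sum => b.
  apply: measurable_funM => //.
  by apply: (measurableT_comp (measurable_tnth b)).
- apply: measurable_funB => //.
  by apply: (measurableT_comp (measurable_tnth i)).
Qed.

End gaussian_vectors.

(** * Likelihood ratios over block-constant vectors *)

Section block_bound.
Context (R : realType).
Add Field real_field : (real_field_theory R).
Variables (n d : nat) (k : 'I_n -> 'I_d).

Let block_size (b : 'I_d) : R := #|[pred i | k i == b]|%:R.
Let block_sum (e : 'I_n -> R) (b : 'I_d) : R := \sum_(i < n | k i == b) e i.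

Let block_size_ge0 b : 0 <= block_size b. Proof. exact: ler0n. Qed.

(** Together with [0^-1 = 0], this lets every formula below include empty
blocks. *)
Let empty_block_sum e b : block_size b = 0 -> block_sum e b = 0.
Proof.
move=> /eqP; rewrite pnatr_eq0 => /eqP /card0_eq b0.
by rewrite /block_sum big1// => i ki; have := b0 i; rewrite inE ki.
Qed.

Let sum_by_blocks (f : 'I_n -> R) :
  \sum_(i < n) f i = \sum_(b < d) \sum_(i < n | k i == b) f i.
Proof. by rewrite (partition_big k xpredT). Qed.

Let sum_const_blocks (c : 'I_d -> R) :
  \sum_(i < n) c (k i) = \sum_(b < d) c b * block_size b.
Proof.
rewrite sum_by_blocks; apply: eq_bigr => b _.
under eq_bigr => i /eqP -> do [].
by rewrite sumr_const mulr_natr.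
Qed.

(** Blockwise, [2 x y <= x^2 + y^2] with weights.  The sum over the blocks in the
bound is the squared norm of the projection of [e] on the vectors that are
constant on blocks. *)
Let block_scalar_product (c : 'I_d -> R) (e : 'I_n -> R) :
  \sum_(i < n) c (k i) * e i <=
  4 * (\sum_(b < d) block_sum e b ^+ 2 / block_size b) +
  (\sum_(i < n) c (k i) ^+ 2) / 16.
Proof.
rewrite sum_by_blocks (sum_const_blocks (fun b => c b ^+ 2)).
rewrite mulr_sumr mulr_suml -big_split/=; apply: ler_sum => b _.
rewrite (eq_bigr (fun i => c b * e i)); last by move=> i /eqP ->.
rewrite -mulr_sumr -/(block_sum e b).
have [n0|n0] := eqVneq (block_size b) 0.
  by rewrite empty_block_sum// n0 invr0 !mulr0 mul0r addr0.
rewrite -subr_ge0 (_ : _ - _ =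
  (2 * block_sum e b - c b * block_size b / 4) ^+ 2 / block_size b); last first.
  by real_field.
by rewrite divr_ge0// sqr_ge0.
Qed.

Let projection_sqnorm (a : 'I_n -> R) (Y : n.-tuple R) : R :=
  \sum_(b < d) block_sum (fun i => tnth Y i - a i) b ^+ 2 / block_size b.

(** The quadratic form is the one of orthogonal rows [q b] of square norm [3 / 8]
(or 0, for an empty block); halved, this gives the coefficient [3 / 16].  As
[|x + w|^2 / 2 <= |x|^2 + |w|^2], the integral over [z] is at most
[exp |w|^2] times the one of [exp (3 |z|^2 / 8)], which is [2 ^ d]. *)
Lemma gaussian_expR_blocks (a w : 'I_n -> R) :
  (\int[gaussian a]_Y
    (expR (\sum_(i < n) w i * (tnth Y i - a i) +
           3 / 16 * projection_sqnorm a Y))%:E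
  <= (2 ^+ d * expR (\sum_(i < n) w i ^+ 2))%:E)%E.
Proof.
pose r b : R := Num.sqrt (3 / 8 / block_size b).
have r2 b : r b ^+ 2 = 3 / 8 / block_size b.
  by rewrite sqr_sqrtr// divr_ge0// divr_ge0.
pose q b i : R := if k i == b then r b else 0.
have qE (z : d.-tuple R) i : \sum_(b < d) tnth z b * q b i = tnth z (k i) * r (k i).
  rewrite (bigD1 (k i))//= big1 ?addr0 /q ?eqxx// => b /negPf kb.
  by rewrite eq_sym kb mulr0.
have := gaussian_expR_quadratic a w q.
under eq_integral => Y _.
  rewrite (_ : \sum_(b < d) _ = 3 / 16 * projection_sqnorm a Y); last first.
    rewrite mulr_sumr; apply: eq_bigr => b _.
    pose S := block_sum (fun i => tnth Y i - a i) b.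
    rewrite (_ : \sum_(i < n) _ = r b * S).
      rewrite exprMn r2; set x := (block_size b)^-1.
      by change (3 / 8 * x * S ^+ 2 / 2 = 3 / 16 * (S ^+ 2 * x)); real_field.
    rewrite /S /block_sum [in RHS]big_mkcond mulr_sumr/=; apply: eq_bigr => i _.
    by rewrite /q; case: ifP; rewrite ?mul0r ?mulr0.
  over.
move=> ->.
rewrite EFinM -standard_gaussian_expR_sqr -ge0_integralZr//; last first.
  apply/measurable_EFinP; apply: measurableT_comp => //.
  apply: measurable_sum => b; apply: measurable_funM => //.
  by apply: measurable_funX; exact: measurable_tnth.
apply: ge0_le_integral_nonmeasurable => z; first by rewrite lee_fin expR_ge0.
rewrite -EFinM -expRD lee_fin ler_expR.
apply: (@le_trans _ _ (\sum_(i < n) ((tnth z (k i) * r (k i)) ^+ 2 + w i ^+ 2))).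
  apply: ler_sum => i _; rewrite qE.
  set x := _ * r _; rewrite -subr_ge0 (_ : _ - _ = (x - w i) ^+ 2 / 2).
    by rewrite divr_ge0// sqr_ge0.
  by real_field.
rewrite big_split/= lerD2r (sum_const_blocks (fun b => (tnth z b * r b) ^+ 2)).
apply: ler_sum => b _; rewrite exprMn r2.
have [n0|n0] := eqVneq (block_size b) 0.
  by rewrite n0 mulr0 mulr_ge0 ?divr_ge0// sqr_ge0.
by rewrite (_ : _ * block_size b = 3 / 8 * tnth z b ^+ 2)//; real_field.
Qed.

(** Among the vectors constant on blocks, let [c0] be nearest to [a] up to 1 in
squared distance, and [w] the difference.  Then [<e, v> = <e, v - w> + <e, w>],
where [v - w] is constant on blocks.  The first term is at most
[4 Q + |v - w|^2 / 16] with [Q] the squared norm of the projection, and the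
second one is a single Gaussian variable.  Since [|w|^2 <= |v|^2 + 1], a part of
[|v|^2] pays for [|v - w|^2 / 16], and another one for the variance of
[<e, w>].  The power [3 / 64] is the one that turns [4 Q] into [3 Q / 16], whose
exponential is integrable. *)
Lemma block_likelihood_bound (a : 'I_n -> R) :
  exists U : n.-tuple (measurableTypeR R) -> R,
  [/\ measurable_fun setT U, (forall Y, 0 <= U Y),
      (\int[gaussian a]_Y (U Y)%:E <= (expR 1 * 2 ^+ d)%:E)%E &
      forall Y (c : 'I_d -> R),
        expR (3 / 16 / 4 * (\sum_(i < n) (c (k i) - a i) * (tnth Y i - a i) -
                        3 / 8 * \sum_(i < n) (c (k i) - a i) ^+ 2)) <= U Y].
Proof.
pose dist (c : 'I_d -> R) := \sum_(i < n) (c (k i) - a i) ^+ 2.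
(* A near-minimiser is enough, at the cost of the constant 1. *)
have [c0 c0P] : exists c0, forall c, dist c0 <= dist c + 1.
  have hi : has_inf (range dist).
    split; first by exists (dist (fun=> 0)); exists (fun=> 0).
    by exists 0 => _ [c _ <-]; apply: sumr_ge0 => i _; exact: sqr_ge0.
  have [_ [c0 _ <-] c0P] := inf_adherent (@ltr01 R) hi.
  exists c0 => c; apply: (le_trans (ltW c0P)); rewrite lerD2r.
  by apply: ge_inf; [exact: hi.2 | exists c].
pose w i := c0 (k i) - a i.
pose W := \sum_(i < n) w i ^+ 2.
have W0 : 0 <= W by apply: sumr_ge0 => i _; exact: sqr_ge0.
pose Q := projection_sqnorm a.
pose L (Y : n.-tuple R) := \sum_(i < n) 3 / 16 / 4 * w i * (tnth Y i - a i).
pose U0 Y := expR (L Y + 3 / 16 * Q Y).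
have mU0 : measurable_fun [set: n.-tuple (measurableTypeR R)] U0.
  apply: measurableT_comp => //; apply: measurable_funD.
    exact: measurable_linear_form.
  apply: measurable_funM => //; apply: measurable_sum => b.
  apply: measurable_funM => //; apply: measurable_funX.
  rewrite /block_sum; under eq_fun do rewrite big_mkcond.
  apply: measurable_sum => i; case: (k i == b) => //.
  by apply: measurable_funB => //; exact: measurable_tnth.
exists (fun Y => expR (3 / 16 / 4 * (1 / 4 - W / 8)) * U0 Y); split.
- exact: measurable_funM.
- by move=> Y; rewrite mulr_ge0// expR_ge0.
- under eq_integral do rewrite EFinM.
  rewrite ge0_integralZl//; last 2 first.
  + exact/measurable_EFinP.
  + by move=> Y _; rewrite lee_fin expR_ge0.
  have := gaussian_expR_blocks a (fun i => 3 / 16 / 4 * w i).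
  set C := expR (3 / 16 / 4 * _) => UP.
  have C0 : (0 <= C%:E)%E by rewrite lee_fin expR_ge0.
  apply: (le_trans (lee_wpmul2l C0 UP)).
  rewrite -EFinM lee_fin mulrCA [leRHS]mulrC -expRD ler_pM2l ?exprn_gt0// ler_expR.
  under eq_bigr do rewrite exprMn.
  rewrite -mulr_sumr -/W -subr_ge0.
  rewrite (_ : _ - _ =
      5 / 16 / 4 / 4 + 31 / 8 / 4 + W * (3 / 16 / 4) * (5 / 16 / 4)).
    by rewrite !addr_ge0 ?mulr_ge0 ?divr_ge0.
  by real_field.
- move=> Y c.
  pose u i := c (k i) - c0 (k i).
  set X := \sum_(i < n) _; set V := \sum_(i < n) _ ^+ 2.
  pose Xu := \sum_(i < n) u i * (tnth Y i - a i).
  pose D := \sum_(i < n) u i ^+ 2.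
  have XE : 3 / 16 / 4 * X = 3 / 16 / 4 * Xu + L Y.
    rewrite !mulr_sumr -big_split/=; apply: eq_bigr => i _.
    by rewrite /u /w; real_field.
  have DE : D <= 2 * V + 2 * W.
    rewrite !mulr_sumr -big_split/=; apply: ler_sum => i _.
    rewrite -subr_ge0 (_ : _ - _ = (c (k i) + c0 (k i) - 2 * a i) ^+ 2).
      exact: sqr_ge0.
    by rewrite /u /w; real_field.
  have := block_scalar_product (fun b => c b - c0 b) (fun i => tnth Y i - a i).
  rewrite -/(Q Y) -/Xu -/D => XuP.
  have WV : W <= V + 1 by exact: c0P.
  rewrite /U0 -expRD ler_expR mulrBr XE -subr_ge0.
  rewrite (_ : _ - _ = 3 / 16 / 4 * ((4 * Q Y + D / 16 - Xu) +
    (2 * V + 2 * W - D) / 16 + (V + 1 - W) / 4)); last by real_field.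
  move: XuP DE WV; rewrite -!(subr_ge0 Xu) -(subr_ge0 D) -(subr_ge0 W) => H1 H2 H3.
  apply: mulr_ge0; first by rewrite divr_ge0.
  by apply: addr_ge0; [apply: addr_ge0|]; rewrite ?divr_ge0.
Qed.

End block_bound.

(** * The prior on the number of pieces *)

Section lambda_bounds.
Context (R : realType).
Add Field real_field : (real_field_theory R).

Lemma log_enE n : (0 < n)%N -> expR (log_en R n) = expR 1 * n%:R.
Proof. by move=> n0; rewrite lnK// posrE mulr_gt0 ?expR_gt0// ltr0n. Qed.

Lemma log_en_ge1 n : (0 < n)%N -> 1 <= log_en R n.
Proof.
move=> n0; rewrite -ler_expR log_enE// ler_pMr ?expR_gt0//.
by rewrite ler1n.
Qed.

Lemma natr_le_expR_log_en n : (0 < n)%N -> n%:R <= expR (log_en R n).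
Proof.
move=> n0; rewrite log_enE// ler_peMl// (le_trans _ (expR_ge1Dx 1))//.
by rewrite lerDl.
Qed.

Lemma expRN1_le_half : expR (- 1) <= 2^-1 :> R.
Proof.
rewrite expRN lef_pV2 ?posrE ?expR_gt0//; exact: expR_ge1Dx.
Qed.

(** Comparison with the geometric series of ratio [1 / 2]. *)
Lemma nneseries_expRN_le1 :
  (\sum_(1 <= k <oo) (expR (- k%:R) : R)%:E <= 1)%E.
Proof.
apply: lime_le; first by apply: is_cvg_nneseries => k _ _; rewrite lee_fin expR_ge0.
apply: nearW => N; rewrite sumEFin lee_fin.
apply: (@le_trans _ _ (1 - 2^-1 ^+ N.-1)); last first.
  by rewrite lerBlDr lerDl exprn_ge0.
elim: N => [|[|N] IH]; [by rewrite big_geq// subrr..|].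
rewrite big_nat_recr//= (le_trans (lerD IH (lexx _)))//.
apply: (@le_trans _ _ (1 - 2^-1 ^+ N + 2^-1 ^+ N.+1)).
  rewrite lerD2l -mulrN1 expRM_natl lerXn2r ?nnegrE ?expR_ge0 ?invr_ge0//.
  exact: expRN1_le_half.
rewrite exprS; set x := 2^-1 ^+ N.
by rewrite (_ : 1 - x + 2^-1 * x = 1 - 2^-1 * x)//; real_field.
Qed.

(** As [c L >= 1], the weights are at most [exp (- k)], whence [W <= 1]; the lower
bound on [W] is its first term. *)
Lemma lambdaE (c : R) n : 1 <= c -> (0 < n)%N ->
  exists W : R, [/\ expR (- (c * log_en R n)) <= W, W <= 1 &
    forall m, lambda c n m = (expR (- (c * m%:R * log_en R n)) / W)%:E].
Proof.
move=> c1 n0.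
pose w k : \bar R := (expR (- (c * k%:R * log_en R n)))%:E.
pose S : \bar R := (\sum_(1 <= k <oo) w k)%E.
have w0 k : (0 <= w k)%E by rewrite lee_fin expR_ge0.
have S1 : (S <= 1)%E.
  apply: le_trans nneseries_expRN_le1; apply: lee_nneseries => // k _.
  rewrite lee_fin ler_expR lerN2 mulrAC ler_peMl//.
  by rewrite mulr_ege1// log_en_ge1.
have Sw : (w 1%N <= S)%E.
  rewrite /S (nneseries_split 1 1)//.
  by rewrite big_nat1 leeDl//; exact: nneseries_ge0.
have Sf : S \is a fin_num.
  by rewrite ge0_fin_numE ?(le_lt_trans S1) ?ltry// (le_trans _ Sw).
exists (fine S); split.
- by rewrite -lee_fin fineK// (le_trans _ Sw)// /w mulr1.
- by rewrite -lee_fin fineK.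
- move=> m; rewrite -[LHS]/(w m / S)%E EFinM -{1}(fineK Sf) inver gt_eqF//.
  rewrite -lte_fin fineK//; apply: lt_le_trans Sw.
  by rewrite lte_fin expR_gt0.
Qed.

End lambda_bounds.

(** * Monotone functions as step functions on the design *)

Section step_functions.
Context (R : realType).

Definition block_index n (S : {set 'I_n}) (i : 'I_n) : nat :=
  #|[pred j in S | (j <= i)%N]|.-1.

Lemma step_designE n (S : {set 'I_n}) m (mu : m.-tuple R) (i : 'I_n) :
  step S mu (design R i) = nth 0 mu (block_index S i).
Proof.
rewrite /step /block_index; congr (nth _ _ _.-1); apply: eq_card => j.
rewrite !inE /design ler_pdivrMr ?ltr0n// divfK ?pnatr_eq0// ler_nat ltnS.
by [].
Qed.

Lemma block_index_lt n (S : {set 'I_n}) (i : 'I_n) :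
  (0 < #|S|)%N -> (block_index S i < #|S|)%N.
Proof.
move=> S0; rewrite /block_index.
have : (#|[pred j in S | (j <= i)%N]| <= #|S|)%N.
  by apply: subset_leq_card; apply/fintype.subsetP => j /andP[].
by lia.
Qed.

Lemma block_index_homo n (S : {set 'I_n}) (i j : 'I_n) :
  (i <= j)%N -> (block_index S i <= block_index S j)%N.
Proof.
move=> ij; rewrite /block_index.
have : (#|[pred l in S | (l <= i)%N]| <= #|[pred l in S | (l <= j)%N]|)%N.
  apply: subset_leq_card; apply/fintype.subsetP => l; rewrite !inE => /andP[->/=].
  by move=> /leq_trans; apply.
by lia.
Qed.

(** A model fixes the exact number of its blocks, so a partition into fewer blocks
is refined arbitrarily. *)
Lemma extend_set n (J : {set 'I_n}) t :
  (#|J| <= t <= n)%N -> exists2 S : {set 'I_n}, J \subset S & #|S| = t.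
Proof.
move=> /andP[Jt tn].
pose s := take (t - #|J|) (enum (~: J)).
have sJ x : x \in s -> x \notin J.
  by move=> /mem_take; rewrite mem_enum inE.
exists (J :|: [set x in s]); first exact: finset.subsetUl.
rewrite cardsU (_ : J :&: _ = finset.set0) ?cards0 ?subn0; last first.
  apply/finset.setP => x; rewrite !inE; apply/negP => /andP[xJ /sJ].
  by rewrite xJ.
rewrite cardsE (card_uniqP _) ?take_uniq ?enum_uniq// size_takel ?subnKC//.
by rewrite -cardE [#|~: J|]cardsCs finset.setCK card_ord leq_sub2r.
Qed.

(** The jumps of [theta], together with 0, are at most [m] and at most [n] in
number; [S] is any set of [min (m, n)] block starts that contains them.  The
value [mu_k] is read off at the last design point whose block index is at most
[k], which makes [mu] sorted without enumerating [S]. *)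
Lemma monotone_step n m (theta : nat -> R) (kappa : 'I_n -> 'I_m) :
  (0 < n)%N ->
  (forall i j, (i <= j < n)%N -> theta i <= theta j) ->
  (forall i j, kappa i = kappa j -> theta i = theta j) ->
  exists (S : {set 'I_n}) (mu : (minn m n).-tuple R),
  [/\ S \in @change_points n (minn m n), sorted <=%R mu,
      forall i : 'I_n, step S mu (design R i) = theta i &
      forall k, exists i : 'I_n, tnth mu k = theta i].
Proof.
move=> n0 hmono hkappa.
pose i0 := Ordinal n0.
pose J : {set 'I_n} :=
  finset (fun i : 'I_n => (val i == 0%N) || (theta i.-1 != theta i)).
have Jm : (#|J| <= m)%N.
  rewrite -[X in (_ <= X)%N](card_ord m).
  apply: (@leq_trans #|kappa @: J|%N); last exact: max_card.
  rewrite card_in_imset//.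
  (* Two jumps at which theta agrees would enclose a jump of theta. *)
  have key i j : i \in J -> j \in J -> kappa i = kappa j -> ~~ (i < j)%N.
    move=> iJ jJ /hkappa tij; apply/negP => ij.
    move: jJ; rewrite inE => /orP[/eqP j0|/negP]; first by rewrite j0 in ij.
    apply; rewrite eq_le hmono ?leq_pred//= -tij; apply: hmono.
    have := ltn_ord j; lia.
  move=> i j iJ jJ kij; apply/val_inj/eqP.
  have := key _ _ iJ jJ kij; have := key _ _ jJ iJ (esym kij).
  by rewrite -!leqNgt eqn_leq => -> ->.
have [|S JS cardS] := @extend_set n J (minn m n).
  by rewrite leq_min Jm geq_minr andbT/= -[X in (_ <= X)%N]card_ord max_card.
have S0 : i0 \in S by apply: (fintype.subsetP JS); rewrite inE eqxx.
have count_gt0 i : (0 < #|[pred j in S | (j <= i)%N]|)%N.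
  by apply/card_gt0P; exists i0; rewrite !inE S0.
have const_block (i j : 'I_n) : (i <= j)%N -> block_index S i = block_index S j ->
    theta i = theta j.
  move=> ij eij.
  have noS (l : 'I_n) : (i < l <= j)%N -> l \notin S.
    move=> /andP[il lj]; apply/negP => lS.
    have : (#|[pred j in S | (j <= i)%N]| < #|[pred l in S | (l <= j)%N]|)%N.
      apply: proper_card; apply/properP; split.
        apply/fintype.subsetP => x; rewrite !inE => /andP[->/=] xi.
        exact: leq_trans xi ij.
      by exists l; rewrite !inE lS ?lj// -ltnNge.
    by have := count_gt0 i; have := count_gt0 j; rewrite /block_index in eij; lia.
  have : forall p, (i + p <= j)%N -> theta i = theta (i + p)%N.
    elim=> [|p IH] pj; first by rewrite addn0.
    rewrite IH; last by lia.
    have pn : (i + p.+1 < n)%N by have := ltn_ord j; lia.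
    have : Ordinal pn \notin J.
      apply/negP => /(fintype.subsetP JS); apply/negP/noS => /=; lia.
    by rewrite inE/= negb_or negbK addnS/= => /eqP.
  by move=> /(_ (j - i)%N); rewrite subnKC//; apply.
(* The last design point of block index at most k. *)
pose i_ (k : 'I_(minn m n)) :=
  [arg max_(i > i0 | (block_index S i <= k)%N) (i : nat)].
have bi0 : block_index S i0 = 0%N.
  rewrite /block_index (_ : #|_| = 1%N)//.
  rewrite -(card1 i0); apply: eq_card => x; rewrite !inE.
  apply/idP/eqP => [/andP[_]|->]; last by rewrite S0.
  by rewrite leqn0 => /eqP x0; apply/val_inj.
have i_P k : (block_index S (i_ k) <= k)%N /\
    forall j : 'I_n, (block_index S j <= k)%N -> (j <= i_ k)%N.
  by rewrite /i_; case: arg_maxnP => [|i ik imax]; rewrite ?bi0.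
pose mu := [tuple theta (i_ k) | k < minn m n].
exists S, mu; split.
- rewrite inE cardS eqxx/=; apply/forallP => i; apply/implyP => /eqP i0E.
  by rewrite (_ : i = i0)//; apply: val_inj.
- apply/(sortedP 0) => k; rewrite size_tuple => kn.
  have k1n : (k < minn m n)%N by exact: ltnW.
  rewrite (_ : k = Ordinal k1n)// (_ : (Ordinal k1n).+1 = Ordinal kn)//.
  rewrite -!tnth_nth !tnth_mktuple; apply: hmono; rewrite ltn_ord andbT.
  by apply: (i_P _).2 => /=; rewrite (leq_trans (i_P _).1).
- move=> i; rewrite step_designE.
  have ilt : (block_index S i < minn m n)%N.
    by rewrite -cardS block_index_lt//; apply/card_gt0P; exists i0.
  rewrite -[block_index S i]/(nat_of_ord (Ordinal ilt)) -tnth_nth tnth_mktuple.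
  have [h1 h2] := i_P (Ordinal ilt).
  have ij := h2 i (leqnn _).
  apply/esym/const_block => //; apply/eqP; rewrite eqn_leq h1 andbT.
  exact: block_index_homo.
- by move=> k; exists (i_ k); rewrite tnth_mktuple.
Qed.

End step_functions.

(** * Prior integrals within one model *)

Section model_integrals.
Context (R : realType).
Add Field real_field : (real_field_theory R).

Lemma likelihood_gt0 n (Y : n.-tuple R) (f : R -> R) : 0 < likelihood Y f.
Proof.
apply: prodr_gt0 => i _; rewrite /normal_pdf oner_eq0.
by rewrite mulr_gt0 ?expR_gt0// normal_peak_gt0// oner_neq0.
Qed.

Lemma likelihood_ratio n (Y : n.-tuple R) (f f0 : R -> R) :
  likelihood Y f = likelihood Y f0 *
    expR (\sum_(i < n) (f (design R i) - f0 (design R i)) *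
                       (tnth Y i - f0 (design R i)) -
          (\sum_(i < n) (f (design R i) - f0 (design R i)) ^+ 2) / 2).
Proof.
rewrite mulr_suml -sumrB expR_sum -big_split/=; apply: eq_bigr => i _.
rewrite (normal_pdf1E (f _)) (normal_pdf1E (f0 _)) -mulrA -expRD.
by congr (_ * expR _); real_field.
Qed.

Lemma ffact_le_expn n m : (n ^_ m <= n ^ m)%N.
Proof.
elim: m => [|m IH]; first by rewrite ffactn0.
by rewrite ffactnSr expnSr leq_mul// leq_subr.
Qed.

Lemma fact_le_expn n m : (m <= n)%N -> (m`! <= n ^ m)%N.
Proof.
case: m => // m mn.
by rewrite -ffactnn (leq_trans (ffact_le_expn _ _))// leq_exp2r.
Qed.

Lemma card_change_points_le n m : (#|@change_points n m| <= n ^ m)%N.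
Proof.
apply: (@leq_trans 'C(n, m)).
  rewrite -[X in 'C(X, _)](card_ord n) -card_draws.
  by apply: subset_leq_card; apply/fintype.subsetP => S; rewrite !inE => /andP[].
apply: (@leq_trans (n ^_ m)); last exact: ffact_le_expn.
by rewrite -bin_ffact leq_pmulr// fact_gt0.
Qed.

(** The density is monotone on the positive half-line only, and its value at 0 is
arbitrary: boxes have to avoid 0. *)
Lemma integral_punctured_itv (a b : R) : a < b ->
  (\int[lebesgue_measure]_x (\1_(`[a, b] `\ 0) x)%:E = (b - a)%:E)%E.
Proof.
move=> ab; rewrite integral_indic//= ?setIT; last exact: measurableD.
rewrite -[LHS]mul1e -integral_cst; last exact: measurableD.
rewrite integral_setD1//; last exact: measurableD.
by rewrite integral_cst//= mul1e lebesgue_measure_itv/= lte_fin ab.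
Qed.

Section models.
Variables (g : R -> R) (gP : prior_density g).

Let g_ge0 x : 0 <= g x. Proof. by case: gP => _ [+ _] _ _; exact. Qed.

Let g_measurable : measurable_fun setT g. Proof. by case: gP. Qed.

Lemma ordered_density_ge0 m (mu : m.-tuple R) : 0 <= ordered_density g mu.
Proof.
by rewrite /ordered_density; case: ifP => // _; rewrite mulr_ge0// prodr_ge0.
Qed.

Let measurable_g_prod m : measurable_fun [set: m.-tuple (measurableTypeR R)]
  (fun mu => \prod_(k < m) g (tnth mu k)).
Proof.
apply: measurable_prod => k _.
by apply: (measurableT_comp g_measurable); exact: measurable_tnth.
Qed.

(** Forgetting the order constraint, the ordered density integrates to at most
[m!]; this loss is affordable because [m! <= n ^ m]. *)
Lemma model_integral_le n m (H : (R -> R) -> \bar R) (B : R) : 0 <= B ->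
  (forall (S : {set 'I_n}) (mu : m.-tuple R),
     S \in @change_points n m -> sorted <=%R mu ->
     (0 <= H (step S mu) <= B%:E)%E) ->
  (model_integral n m g H <= (m`!%:R * B)%:E)%E.
Proof.
move=> B0 HB; rewrite /model_integral.
set P := change_points m.
have le S : S \in P -> (\int[lebesgue_tuple R m]_mu
    ((ordered_density g mu)%:E * H (step S mu)) <= (m`!%:R * B)%:E)%E.
  move=> cS.
  have <- : (\int[lebesgue_tuple R m]_mu
      ((m`!%:R * B)%:E * (\prod_(k < m) g (tnth mu k))%:E) = (m`!%:R * B)%:E)%E.
    rewrite ge0_integralZl//; last 3 first.
    - by apply/measurable_EFinP; exact: measurable_g_prod.
    - by move=> mu _; rewrite lee_fin prodr_ge0.
    - by rewrite lee_fin mulr_ge0.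
    rewrite (@integral_tuple_measure_prod _ (measurableTypeR R) R m _
      (fun _ => g) (fun=> 1))//; first by rewrite big1// mule1.
    by move=> _; case: gP => _ [_ + _].
  apply: ge0_le_integral_nonmeasurable => mu; rewrite /ordered_density.
    case: ifP => [smu|_]; last by rewrite mul0e.
    have /andP[H0 _] := HB S mu cS smu.
    by rewrite mule_ge0// lee_fin mulr_ge0// prodr_ge0.
  case: ifP => [smu|_]; last first.
    by rewrite mul0e mule_ge0// lee_fin ?prodr_ge0// mulr_ge0.
  have /andP[H0 H1] := HB S mu cS smu.
  rewrite -[leRHS]EFinM [in leRHS]mulrAC [leRHS]EFinM.
  by rewrite lee_wpmul2l// lee_fin mulr_ge0// prodr_ge0.
apply: (@le_trans _ _ ((#|P|%:R^-1)%:E * \sum_(S in P) (m`!%:R * B)%:E)%E).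
  by rewrite lee_wpmul2l ?lee_fin// lee_sum.
rewrite sumEFin sumr_const -EFinM lee_fin -[X in _ * X <= _]mulr_natl mulrA.
have [->|P0] := eqVneq #|P| 0%N; first by rewrite mulr0 mul0r mulr_ge0.
by rewrite mulVf ?mul1r// pnatr_eq0.
Qed.

Lemma model_integral_homo n m (H1 H2 : (R -> R) -> \bar R) :
  (forall f, 0 <= H1 f)%E -> (forall f, H1 f <= H2 f)%E ->
  (model_integral n m g H1 <= model_integral n m g H2)%E.
Proof.
move=> H10 H12; rewrite /model_integral lee_wpmul2l ?lee_fin//.
apply: lee_sum => S _; apply: ge0_le_integral_nonmeasurable => mu.
  by rewrite mule_ge0// lee_fin ordered_density_ge0.
by rewrite lee_wpmul2l// lee_fin ordered_density_ge0.
Qed.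

Lemma model_integral_ge0 n m (H : (R -> R) -> \bar R) :
  (forall f, 0 <= H f)%E -> (0 <= model_integral n m g H)%E.
Proof.
move=> H0; rewrite /model_integral mule_ge0 ?lee_fin//.
apply: sume_ge0 => S _; apply: integral_ge0 => mu _.
by rewrite mule_ge0// lee_fin ordered_density_ge0.
Qed.

(** The boxes [lo k, hi k] of length [n^-2] are shifted to the right by [k / n^2],
so that every point of their product is sorted, while staying within [1 / n]
of [mu]. *)
Lemma model_integral_ge n m (H : (R -> R) -> \bar R) (B tau : R)
    (S : {set 'I_n}) (mu : m.-tuple R) :
  (0 < n)%N -> (m <= n)%N -> S \in @change_points n m -> sorted <=%R mu ->
  0 <= B -> 0 <= tau -> (forall f, 0 <= H f)%E ->
  (forall k x, tnth mu k <= x <= tnth mu k + n%:R^-1 -> x != 0 -> tau <= g x) ->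
  (forall nu : m.-tuple R,
    (forall k, tnth mu k <= tnth nu k <= tnth mu k + n%:R^-1) ->
    (B%:E <= H (step S nu))%E) ->
  ((n%:R ^- m * ((tau / n%:R ^+ 2) ^+ m * B))%:E <= model_integral n m g H)%E.
Proof.
move=> n0 mn SP smu B0 tau0 H0 gtau HB.
have n0R : 0 < n%:R :> R by rewrite ltr0n.
have n2 : 0 < n%:R ^+ 2 :> R by rewrite exprn_gt0.
pose lo (k : 'I_m) : R := tnth mu k + k%:R / n%:R ^+ 2.
pose hi (k : 'I_m) : R := tnth mu k + k.+1%:R / n%:R ^+ 2.
pose box k : set R := `[lo k, hi k] `\ 0.
have lohi k : hi k - lo k = (n%:R ^+ 2)^-1.
  by rewrite opprD addrACA subrr add0r -mulrBl -natrB// subSnn mul1r.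
have cell k x : box k x -> tnth mu k <= x <= tnth mu k + n%:R^-1.
  move=> [/=]; rewrite in_itv/= => /andP[lx xh] _; apply/andP; split.
    by apply: le_trans lx; rewrite lerDl divr_ge0// ltW.
  apply: (le_trans xh); rewrite lerD2l ler_pdivrMr// expr2 mulKf ?gt_eqF//.
  by rewrite ler_nat (leq_trans _ mn).
have mbox k : measurable_fun setT (\1_(box k) : R -> R).
  by apply: measurable_indic; exact: measurableD.
have ibox : (\int[lebesgue_tuple R m]_nu
    (\prod_(k < m) \1_(box k) (tnth nu k))%:E = ((n%:R ^+ 2) ^- m)%:E)%E.
  rewrite (@integral_tuple_measure_prod _ (measurableTypeR R) R m _
      (fun k => \1_(box k)) (fun=> (n%:R ^+ 2)^-1)).
  - by rewrite prodr_const card_ord exprVn.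
  - exact: mbox.
  - by move=> k x; rewrite indicE.
  - move=> k; rewrite -(lohi k); apply: integral_punctured_itv.
    by rewrite -subr_gt0 lohi invr_gt0.
have intS : (((tau / n%:R ^+ 2) ^+ m * B)%:E <= \int[lebesgue_tuple R m]_nu
    ((ordered_density g nu)%:E * H (step S nu)))%E.
  have -> : (((tau / n%:R ^+ 2) ^+ m * B)%:E =
     \int[lebesgue_tuple R m]_nu
      ((tau ^+ m * B)%:E * (\prod_(k < m) \1_(box k) (tnth nu k))%:E))%E.
    rewrite ge0_integralZl//; last 3 first.
    - apply/measurable_EFinP; apply: measurable_prod => k _.
      by apply: (measurableT_comp (mbox k)); exact: measurable_tnth.
    - by move=> nu _; rewrite lee_fin prodr_ge0// => k _; rewrite indicE.
    - by rewrite lee_fin mulr_ge0// exprn_ge0.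
    by rewrite ibox -EFinM expr_div_n mulrAC.
  apply: ge0_le_integral_nonmeasurable => nu.
    by rewrite lee_fin mulr_ge0// ?mulr_ge0 ?exprn_ge0// prodr_ge0// => k _;
      rewrite indicE.
  have [inbox|] := pselect (forall k, box k (tnth nu k)); last first.
    move=> /existsNP[k nk]; rewrite (bigD1 k)//= indicE memNset// mul0r mule0.
    by rewrite mule_ge0// lee_fin ordered_density_ge0.
  rewrite big1 ?mule1; last by move=> k _; rewrite indicE mem_set.
  rewrite EFinM; apply: lee_pmul; rewrite ?lee_fin ?exprn_ge0//; last first.
    by apply: HB => k; exact: cell.
  rewrite /ordered_density ifT; last first.
    apply/(sortedP 0) => k; rewrite size_tuple => km.
    have k1m : (k < m)%N by exact: ltnW.
    rewrite (_ : k = Ordinal k1m)// (_ : (Ordinal k1m).+1 = Ordinal km)//.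
    rewrite -!tnth_nth; have := inbox (Ordinal k1m) => -[/=].
    rewrite in_itv/= => /andP[_ h1] _; have := inbox (Ordinal km) => -[/=].
    rewrite in_itv/= => /andP[h2 _] _; apply: (le_trans h1); apply: le_trans h2.
    rewrite /hi /lo/= lerD2r !(tnth_nth 0)/=.
    by move/(sortedP 0) : smu; apply; rewrite size_tuple.
  rewrite -[leLHS]mul1r ler_pM ?exprn_ge0// ?ler1n ?fact_gt0//.
  rewrite -[X in _ ^+ X](card_ord m) -prodr_const; apply: ler_prod => k _.
  rewrite tau0/=; apply: (gtau k); first exact: cell.
  by have [_ /eqP] := inbox k.
rewrite /model_integral EFinM; apply: lee_pmul => //.
- by rewrite lee_fin mulr_ge0// exprn_ge0// divr_ge0// ltW.
- rewrite lee_fin lef_pV2 ?posrE ?exprn_gt0// ?ltr0n.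
    by rewrite -natrX ler_nat card_change_points_le.
  by apply/card_gt0P; exists S.
- rewrite (bigD1 S)//=; apply: (le_trans intS); rewrite leeDl//.
  apply: sume_ge0 => S' _; apply: integral_ge0 => nu _.
  by rewrite mule_ge0// lee_fin ordered_density_ge0.
Qed.

End models.
End model_integrals.

(** * Prior integrals over all models *)

Section prior_bounds.
Context (R : realType).
Add Field real_field : (real_field_theory R).
Variables (g : R -> R) (gP : prior_density g).

Lemma lambda_ge0 (c : R) n m : 1 <= c -> (0 < n)%N -> (0 <= lambda c n m)%E.
Proof.
move=> c1 n0; have [W [W0 _ ->]] := lambdaE c1 n0.
by rewrite lee_fin divr_ge0 ?expR_ge0// (le_trans _ W0)// expR_ge0.
Qed.

Lemma lambda_ge (c : R) n m : 1 <= c -> (0 < n)%N ->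
  ((expR (- (c * m%:R * log_en R n)))%:E <= lambda c n m)%E.
Proof.
move=> c1 n0; have [W [W0 W1 ->]] := lambdaE c1 n0.
have Wgt0 : 0 < W by apply: lt_le_trans W0; exact: expR_gt0.
by rewrite lee_fin ler_pdivlMr// ler_piMr// expR_ge0.
Qed.

Lemma prior_integral_ge0 (c : R) n (H : (R -> R) -> \bar R) :
  1 <= c -> (0 < n)%N -> (forall f, 0 <= H f)%E ->
  (0 <= prior_integral c n g H)%E.
Proof.
move=> c1 n0 H0; apply: nneseries_ge0 => k _ _.
by rewrite mule_ge0 ?lambda_ge0// model_integral_ge0.
Qed.

Lemma prior_integral_ge (c : R) n m (H : (R -> R) -> \bar R) :
  1 <= c -> (0 < n)%N -> (0 < m)%N -> (forall f, 0 <= H f)%E ->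
  (lambda c n m * model_integral n (minn m n) g H <= prior_integral c n g H)%E.
Proof.
move=> c1 n0 m0 H0.
have t0 k : (0 <= lambda c n k * model_integral n (minn k n) g H)%E.
  by rewrite mule_ge0 ?lambda_ge0// model_integral_ge0.
rewrite /prior_integral (nneseries_split 1 m)//.
case: m m0 => // m _; rewrite add1n big_nat_recr//=.
rewrite -addeA addeC -addeA leeDl// adde_ge0//.
  exact: nneseries_ge0.
exact: sume_ge0.
Qed.

Lemma prior_integral_homo (c : R) n (H1 H2 : (R -> R) -> \bar R) :
  1 <= c -> (0 < n)%N ->
  (forall f, 0 <= H1 f)%E -> (forall f, H1 f <= H2 f)%E ->
  (prior_integral c n g H1 <= prior_integral c n g H2)%E.
Proof.
move=> c1 n0 H10 H12; apply: lee_nneseries => k _.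
  by rewrite mule_ge0 ?lambda_ge0// model_integral_ge0.
by rewrite lee_wpmul2l ?lambda_ge0// model_integral_homo.
Qed.

(** The factor [exp (- c k L)] of the prior absorbs [exp (K k L)] and the
factorial [k! <= exp (k L)], and leaves the convergent series of
[exp (- k)]; [exp (c L)] comes from the normalising constant. *)
Lemma prior_integral_le (c K B : R) n (H : (R -> R) -> \bar R) :
  0 <= K -> c = K + 2 -> (0 < n)%N -> 0 <= B ->
  (forall m (S : {set 'I_n}) (mu : m.-tuple R),
     S \in @change_points n m -> sorted <=%R mu ->
     (0 <= H (step S mu) <= (B * expR (K * m%:R * log_en R n))%:E)%E) ->
  (prior_integral c n g H <= (B * expR (c * log_en R n))%:E)%E.
Proof.
move=> K0 cK n0 B0 HB.
have c1 : 1 <= c by rewrite cK -lerBlDr (le_trans _ K0)// lerBlDr add0r ler1n.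
set L := log_en R n.
have L1 : 1 <= L by exact: log_en_ge1.
have [W [WL W1 lamE]] := lambdaE c1 n0.
have W0 : 0 < W by apply: lt_le_trans WL; exact: expR_gt0.
have C0 : 0 <= B * expR (c * L) by rewrite mulr_ge0// expR_ge0.
apply: (@le_trans _ _ (\sum_(1 <= k <oo)
    ((B * expR (c * L))%:E * (expR (- k%:R))%:E))%E); last first.
  rewrite nneseriesZl; last by move=> k _; rewrite lee_fin expR_ge0.
  have C0e : (0 <= (B * expR (c * L))%:E)%E by rewrite lee_fin.
  by have := lee_wpmul2l C0e (nneseries_expRN_le1 R); rewrite mule1.
have mE k : (model_integral n (minn k n) g H <=
    (B * expR ((K + 1) * k%:R * L))%:E)%E.
  have B'0 : 0 <= B * expR (K * (minn k n)%:R * L) by rewrite mulr_ge0// expR_ge0.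
  apply: (le_trans (model_integral_le gP B'0 (HB (minn k n)))).
  rewrite lee_fin mulrCA ler_wpM2l// mulrDl mul1r mulrDl expRD mulrC.
  have kn : (minn k n)%:R <= k%:R :> R by rewrite ler_nat geq_minl.
  apply: ler_pM; rewrite ?expR_ge0//.
    rewrite ler_expR ler_wpM2r ?ler_wpM2l//; exact: le_trans L1.
  apply: (@le_trans _ _ (expR L ^+ minn k n)); last first.
    rewrite -expRM_natl ler_expR ler_wpM2r//; exact: le_trans L1.
  apply: (@le_trans _ _ (n%:R ^+ minn k n)).
    by rewrite -natrX ler_nat fact_le_expn// geq_minr.
  by rewrite lerXn2r ?nnegrE ?expR_ge0// natr_le_expR_log_en.
have t0 k : (0 <= lambda c n k * model_integral n (minn k n) g H)%E.
  rewrite mule_ge0 ?lambda_ge0//; rewrite /model_integral mule_ge0 ?lee_fin//.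
  apply: sume_ge0 => S SP; apply: integral_ge0 => mu _.
  rewrite /ordered_density; case: ifP => [smu|_]; last by rewrite mul0e.
  have /andP[H0 _] := HB _ _ _ SP smu.
  rewrite mule_ge0// lee_fin mulr_ge0// prodr_ge0// => j _.
  by case: gP => _ [+ _] _ _; exact.
apply: lee_nneseries => k _; first by move=> _; exact: t0.
apply: (@le_trans _ _ (lambda c n k * (B * expR ((K + 1) * k%:R * L))%:E)%E).
  by rewrite lee_wpmul2l ?lambda_ge0.
rewrite lamE -!EFinM lee_fin -/L.
rewrite [leLHS](_ : _ = B * (W^-1 * expR (- (k%:R * L)))); last first.
  rewrite (_ : - (k%:R * L) = - (c * k%:R * L) + (K + 1) * k%:R * L).
    by rewrite expRD; set x := W^-1; real_field.
  by rewrite cK; real_field.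
rewrite -mulrA ler_wpM2l// ler_pM ?invr_ge0 ?expR_ge0// ?(ltW W0)//.
  by rewrite -[expR (c * L)]invrK -expRN lef_pV2// posrE expR_gt0.
by rewrite ler_expR lerN2 ler_peMr.
Qed.

End prior_bounds.

(** * Random bounds for the likelihood ratios *)

Section likelihood_bounds.
Context (R : realType).
Add Field real_field : (real_field_theory R).
Variables (n : nat) (n0 : (0 < n)%N).

(** With [v] the difference of the step function and [a], the exponential is the
power [3 / 64] of the likelihood ratio times [exp (|v|^2 / 8)]: the coefficient
[3 / 8] is [1 / 2 - 1 / 8]. *)
Definition step_likelihood_bound (a : 'I_n -> R) (S : {set 'I_n})
    (U : n.-tuple (measurableTypeR R) -> R) : Prop :=
  [/\ measurable_fun setT U, (forall Y, 0 <= U Y),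
      (\int[gaussian a]_Y (U Y)%:E <= (expR 1 * 2 ^+ #|S|)%:E)%E &
      forall m (mu : m.-tuple R) (Y : n.-tuple R), S \in @change_points n m ->
        expR (3 / 16 / 4 * (\sum_(i < n) (step S mu (design R i) - a i) *
                                         (tnth Y i - a i) -
          3 / 8 * \sum_(i < n) (step S mu (design R i) - a i) ^+ 2)) <= U Y].

(** Nonempty sets are covered by the bound for blocks; the empty set starts no
partition and receives the bound 0. *)
Lemma step_likelihood_bounds (a : 'I_n -> R) :
  exists U, forall S, step_likelihood_bound a S (U S).
Proof.
suff /boolp.choice[U UP] : forall S, exists U, step_likelihood_bound a S U.
  by exists U.
move=> S; have [S0|S0] := posnP #|S|.
  exists (fun=> 0); split => //.
    by rewrite integral0 lee_fin mulr_ge0 ?expR_ge0// exprn_ge0.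
  move=> m mu Y /andP[_ /forallP/(_ (Ordinal n0))] /=.
  by rewrite (card0_eq S0).
pose k (i : 'I_n) := Ordinal (block_index_lt i S0).
have [U [mU U0 iU Ub]] := block_likelihood_bound k a.
exists U; split => // m mu Y /andP[/eqP Sm _].
have stepE i : step S mu (design R i) = nth 0 mu (k i) by rewrite step_designE.
under eq_bigr do rewrite stepE.
under [X in _ - _ * X]eq_bigr do rewrite stepE.
exact: (Ub Y (fun b => nth 0 mu b)).
Qed.

(** A perturbation [h] with entries at most [1 / n] changes the exponent by at
most the mean of the [|e_i|], and Jensen's inequality bounds the exponential of
this mean by the mean of the [exp |e_i|].  Hence [V] is a mean of exponentials
of linear forms in the noise. *)
Lemma inverse_likelihood_bound (a w : 'I_n -> R) :
  exists V : n.-tuple (measurableTypeR R) -> R,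
  [/\ measurable_fun setT V, (forall Y, 0 < V Y),
      (\int[gaussian a]_Y (V Y)%:E <=
        (2 * expR (2 * (\sum_(i < n) w i ^+ 2) + 2))%:E)%E &
      forall Y (h : 'I_n -> R), (forall i, `|h i| <= n%:R^-1) ->
        expR (- (\sum_(i < n) (w i + h i) * (tnth Y i - a i) -
                 (\sum_(i < n) (w i + h i) ^+ 2) / 2)) <= V Y].
Proof.
have nR : 0 < n%:R :> R by rewrite ltr0n.
pose W := \sum_(i < n) w i ^+ 2.
pose u (s : bool) (j i : 'I_n) := - w i + (if s then 1 else - 1) * (i == j)%:R.
pose X s j (Y : n.-tuple R) := \sum_(i < n) u s j i * (tnth Y i - a i).
pose V (Y : n.-tuple R) := n%:R^-1 * expR (W + 1) *
  \sum_(j < n) (expR (X true j Y) + expR (X false j Y)).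
have mX s j : measurable_fun [set: n.-tuple (measurableTypeR R)]
    (fun Y => expR (X s j Y)).
  by apply: measurableT_comp => //; exact: measurable_linear_form.
exists V; split.
- by apply: measurable_funM => //; apply: measurable_sum => j;
    exact: measurable_funD.
- move=> Y; rewrite /V mulr_gt0 ?mulr_gt0 ?invr_gt0 ?expR_gt0//.
  rewrite (bigD1 (Ordinal n0))//=; apply: ltr_wpDr.
    by apply: sumr_ge0 => j _; rewrite addr_ge0// expR_ge0.
  by rewrite addr_gt0 ?expR_gt0.
- under eq_integral do rewrite EFinM -sumEFin.
  have mXE s j : measurable_fun [set: n.-tuple (measurableTypeR R)]
      (fun Y => (expR (X s j Y))%:E).
    by apply/measurable_EFinP; exact: mX.
  rewrite ge0_integralZl//; last 2 first.
  + apply: emeasurable_sum => j; apply/measurable_EFinP.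
    exact: measurable_funD.
  + by move=> Y _; apply: sume_ge0 => j _; rewrite lee_fin addr_ge0 ?expR_ge0.
  rewrite ge0_integral_sum//; last first.
    by move=> j; apply/measurable_EFinP; exact: measurable_funD.
  have iX s j : (\int[gaussian a]_Y (expR (X s j Y))%:E <=
      (expR (W + 1))%:E)%E.
    rewrite gaussian_expR lee_fin ler_expR.
    apply: (@le_trans _ _ (\sum_(i < n) (w i ^+ 2 + (i == j)%:R))).
      apply: ler_sum => i _; rewrite /u.
      set t : R := (i == j)%:R.
      have t2 : t ^+ 2 = t by rewrite /t; case: (i == j); rewrite ?expr1n ?expr0n.
      rewrite -[X in _ <= _ + X]t2 -subr_ge0.
      case: s; [pose z := w i + t|pose z := w i - t].
        rewrite (_ : _ - _ = z ^+ 2 / 2) ?divr_ge0 ?sqr_ge0//.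
        by rewrite /z; real_field.
      rewrite (_ : _ - _ = z ^+ 2 / 2) ?divr_ge0 ?sqr_ge0//.
      by rewrite /z; real_field.
    rewrite big_split/= lerD2l (bigD1 j)//= eqxx big1 ?addr0// => i /negPf ->.
    by [].
  apply: (@le_trans _ _ ((n%:R^-1 * expR (W + 1))%:E *
      (\sum_(j < n) (2 * expR (W + 1))%:E))%E).
    rewrite lee_wpmul2l ?lee_fin ?mulr_ge0 ?expR_ge0 ?invr_ge0//.
    apply: lee_sum => j _.
    under eq_integral do rewrite EFinD.
    rewrite ge0_integralD//.
    by rewrite mulr_natl mulr2n EFinD leeD.
  rewrite sumEFin sumr_const card_ord -EFinM lee_fin -[X in _ * X <= _]mulr_natl.
  rewrite (_ : 2 * W + 2 = (W + 1) + (W + 1)); last by real_field.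
  rewrite (expRD (W + 1) (W + 1)); set e := expR (W + 1).
  by rewrite [leLHS](_ : _ = 2 * (e * e))//; set k : R := n%:R; real_field.
- move=> Y h hn.
  pose e i := tnth Y i - a i.
  pose t := n%:R^-1 * \sum_(i < n) `|e i|.
  have hb : - (\sum_(i < n) (w i + h i) * e i -
               (\sum_(i < n) (w i + h i) ^+ 2) / 2) <=
      W + 1 + t - \sum_(i < n) w i * e i.
    rewrite opprB lerBlDr; apply: (@le_trans _ _ (W + \sum_(i < n) h i ^+ 2)).
      rewrite -big_split mulr_suml; apply: ler_sum => i _ /=.
      rewrite -subr_ge0 (_ : _ - _ = (w i - h i) ^+ 2 / 2); last by real_field.
      by rewrite divr_ge0// sqr_ge0.
    have h2 : \sum_(i < n) h i ^+ 2 <= 1.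
      apply: (@le_trans _ _ (\sum_(i < n) n%:R^-1)); last first.
        by rewrite sumr_const card_ord -[X in X <= _]mulr_natl divff// gt_eqF.
      apply: ler_sum => i _; rewrite -real_normK ?num_real// expr2.
      rewrite -[leRHS]mul1r ler_pM// (le_trans (hn i))//.
      by rewrite invf_le1// ler1n.
    have he : - \sum_(i < n) h i * e i <= t.
      rewrite /t mulr_sumr -sumrN; apply: ler_sum => i _.
      rewrite (le_trans (ler_norm _))// normrN normrM ler_wpM2r//.
    have -> : \sum_(i < n) (w i + h i) * e i =
        \sum_(i < n) w i * e i + \sum_(i < n) h i * e i.
      by rewrite -big_split/=; apply: eq_bigr => i _; rewrite mulrDl.
    move: h2 he; set A := \sum_(i < n) h i ^+ 2; set C := \sum_(i < n) h i * e i.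
    set B := \sum_(i < n) w i * e i => h2 he.
    rewrite -subr_ge0 (_ : _ - _ = (1 - A) + (t - (- C))); last by real_field.
    by rewrite addr_ge0// subr_ge0.
  have jensen : expR t <= n%:R^-1 * \sum_(i < n) (expR (e i) + expR (- e i)).
    rewrite -(ler_pM2l nR) mulrA divff ?gt_eqF// mul1r.
    apply: (@le_trans _ _ (\sum_(i < n) expR t * (1 + (`|e i| - t)))).
      rewrite -mulr_sumr big_split/= sumrB !sumr_const card_ord.
      rewrite -[t *+ n]mulr_natl /t mulrA divff ?gt_eqF// mul1r subrr addr0.
      by rewrite mulrC.
    apply: ler_sum => i _.
    apply: (@le_trans _ _ (expR `|e i|)).
      rewrite -[X in _ <= expR X](subrKC t) expRD ler_wpM2l ?expR_ge0//.
      exact: expR_ge1Dx.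
    by case: (ger0P (e i)) => _; rewrite ?lerDl ?lerDr expR_ge0.
  apply: (@le_trans _ _ (expR (W + 1 + t - \sum_(i < n) w i * e i))).
    by rewrite ler_expR.
  rewrite /V (_ : W + 1 + t - _ =
    (W + 1) + (- (\sum_(i < n) w i * e i) + t)); last first.
    by set A := \sum_(i < n) _; real_field.
  rewrite expRD mulrAC [leRHS]mulrC ler_wpM2l ?expR_ge0// expRD.
  have -> : \sum_(j < n) (expR (X true j Y) + expR (X false j Y)) =
      expR (- \sum_(i < n) w i * e i) * \sum_(i < n) (expR (e i) + expR (- e i)).
    have XE s j : X s j Y =
        - (\sum_(i < n) w i * e i) + (if s then 1 else - 1) * e j.
      rewrite /X /u -sumrN.
      under eq_bigr do rewrite mulrDl mulNr.
      rewrite big_split/=; congr (_ + _).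
      rewrite (bigD1 j)//= eqxx mulr1 big1 ?addr0// => i /negPf ->.
      by rewrite mulr0 mul0r.
    rewrite mulr_sumr; apply: eq_bigr => j _.
    by rewrite !XE mul1r mulN1r !expRD mulrDr.
  by rewrite mulrCA ler_wpM2l ?expR_ge0.
Qed.

End likelihood_bounds.

(** * Step functions close to the best approximation *)

Section oracle.
Context (R : realType).
Variables (g : R -> R) (gP : prior_density g).

Lemma supnorm_ge (f : R -> R) x : iso f -> x \in `[0, 1] -> `|f x| <= supnorm f.
Proof.
move=> fi x01; apply: ub_le_sup; last by exists x.
exists (Num.max `|f 0| `|f 1|) => _ [y y01 <-].
have i0 : (0 : R) \in `[0, 1] by rewrite in_itv/= lexx ler01.
have i1 : (1 : R) \in `[0, 1] by rewrite in_itv/= lexx ler01.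
have y01' : y \in `[0, 1] by [].
have /andP[y0 y1] : 0 <= y <= 1 by move: y01'; rewrite in_itv.
have f0y := fi _ _ i0 y01' y0; have fy1 := fi _ _ y01' i1 y1.
rewrite le_max; case: (ger0P (f y)) => fy.
  by rewrite (le_trans fy1 (ler_norm _)) orbT.
by rewrite -[`|f 0|]normrN (le_trans _ (ler_norm _))// lerN2.
Qed.

Lemma design_in01 n (i : 'I_n) : design R i \in `[0, 1].
Proof.
rewrite in_itv/= /design divr_ge0//= ler_pdivrMr ?ltr0n// mul1r ler_nat.
exact: leqW.
Qed.

(** As [tau] is a positive supremum, some best approximation [f] has
[g (supnorm f + 1) >= tau / 2]; the values of [f] moved by at most [1 / n <= 1]
remain below [supnorm f + 1] in absolute value. *)
Lemma oracle_step n m (f0 : R -> R) : (0 < n)%N -> 0 < tau_iso n m g f0 ->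
  exists (S : {set 'I_n}) (mu : (minn m n).-tuple R),
  [/\ S \in @change_points n (minn m n), sorted <=%R mu,
      \sum_(i < n) (step S mu (design R i) - f0 (design R i)) ^+ 2 <=
        n%:R * eps2_iso n m f0 &
      forall k x, tnth mu k <= x <= tnth mu k + n%:R^-1 -> x != 0 ->
        tau_iso n m g f0 / 2 <= g x].
Proof.
move=> n0 tau0.
have nR : 0 < n%:R :> R by rewrite ltr0n.
have [_ _ gsym gmono] := gP.
pose T := [set g (supnorm f + 1) | f in best_approx n m f0].
have hs : has_sup T.
  by apply: contrapT => /sup_out T0; move: tau0; rewrite /tau_iso -/T T0 ltxx.
have [_ [f fbest <-] fT] := sup_adherent (divr_gt0 tau0 (ltr0n R 2)) hs.
have [[fi [I [Icov _ Iconst]]] _ fopt] := fbest.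
have /boolp.choice[kappa kP] : forall i : 'I_n, exists k, design R i \in I k.
  move=> i; have : (\bigcup_k [set` I k]) (design R i).
    by rewrite Icov; exact: design_in01.
  by move=> [k _ Ik]; exists k.
pose theta (i : nat) := f (i.+1%:R / n.+1%:R).
have thetaE (i : 'I_n) : theta i = f (design R i) by [].
have [||S [mu [SP smu stepE muE]]] := @monotone_step R n m theta kappa n0.
- move=> i j /andP[ij jn]; have iN := leq_ltn_trans ij jn.
  apply: (fi (design R (Ordinal iN)) (design R (Ordinal jn)));
    try exact: design_in01.
  by rewrite /design/= ler_pM2r ?invr_gt0 ?ltr0n// ler_nat.
- move=> i j kij; rewrite !thetaE.
  by apply: (Iconst (kappa i)); rewrite ?kP// kij kP.
exists S, mu; split => //.
- apply: (@le_trans _ _ (n%:R * sqloss n f0 f)).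
    rewrite /sqloss mulrA divff ?mul1r ?gt_eqF//; apply: ler_sum => i _.
    by rewrite stepE thetaE -sqrrN opprB.
  rewrite ler_pM2l// /eps2_iso le_max; apply/orP; left.
  apply: lb_le_inf; first by exists (sqloss n f0 f); exists f => //; case: fbest.
  move=> _ [h hP <-].
  exact: fopt.
- move=> k x /andP[mx xm] x0.
  have [i kE] := muE k.
  have mub : `|tnth mu k| <= supnorm f.
    by rewrite kE thetaE; apply: supnorm_ge => //; exact: design_in01.
  have n1 : n%:R^-1 <= 1 :> R by rewrite invf_le1// ler1n.
  have xb : `|x| <= supnorm f + 1.
    move: mub; rewrite !ler_norml => /andP[h1 h2]; apply/andP; split.
      by apply: le_trans mx; apply: le_trans h1; rewrite opprD lerBlDr lerDl.
    by apply: (le_trans xm); rewrite lerD.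
  have gx : g x = g `|x| by case: (ger0P x).
  rewrite gx; apply: le_trans (gmono _ _ _ xb); last by rewrite normr_gt0.
  apply: ltW; apply: le_lt_trans fT.
  by rewrite lerBrDr -splitr.
Qed.

End oracle.

(** * The posterior probability of the complement of the ball *)

Section posterior.
Context (R : realType).
Add Field real_field : (real_field_theory R).

(** The posterior is a quotient of extended reals, where [0 / 0 = 0] and
[+oo / +oo = 0]; both conventions respect the bound. *)
Lemma dive_le1 (x y : \bar R) : (0 <= x)%E -> (x <= y)%E -> (x / y <= 1)%E.
Proof.
move=> x0 xy; case: (inveP y) xy => [|||r r0] xy.
- by rewrite (_ : x = 0%E) ?mul0e//; apply/eqP; rewrite eq_le xy.
- by rewrite mule0.
- by have := le_trans x0 xy.
- have r_gt0 : 0 < r by rewrite lt0r r0 -lee_fin (le_trans x0 xy).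
  by rewrite lee_pdivrMr// mul1e.
Qed.

Lemma dive_le (x y : \bar R) (a b : R) : (0 <= x)%E -> (x <= a%:E)%E ->
  (b%:E <= y)%E -> 0 < b -> (x / y <= (a / b)%:E)%E.
Proof.
move=> x0 xa bey b0.
have a0 : 0 <= a by rewrite -lee_fin (le_trans x0).
case: (inveP y) bey => [|||r r0] bey.
- by have := lt_le_trans b0 bey; rewrite ltxx.
- by rewrite mule0 lee_fin divr_ge0// ltW.
- by [].
- have br : b <= r by rewrite -lee_fin.
  have r_gt0 := lt_le_trans b0 br.
  rewrite EFinM lee_pmul// ?lee_fin ?invr_ge0 ?(ltW r_gt0)//.
  by rewrite lef_pV2.
Qed.

Lemma integral_gaussian_cst n (a : 'I_n -> R) (r : R) :
  (\int[gaussian a]_Y r%:E = r%:E)%E.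
Proof.
have := gaussian_expR a (fun=> 0).
rewrite (eq_integral (cst 1%E)) => [|Y _]; last first.
  by rewrite big1 ?expR0// => i _; rewrite mul0r.
rewrite !integral_cst// mul1e => ->.
by rewrite big1 ?expR0 ?mule1// => i _; rewrite expr0n mul0r.
Qed.

(** The binomial theorem, summed over subsets instead of cardinals. *)
Lemma sum_subsets n (x : R) : \sum_(S : {set 'I_n}) x ^+ #|S| = (x + 1) ^+ n.
Proof.
rewrite -[in RHS](card_ord n) -prodr_const.
rewrite finset.bigA_distr; apply: eq_bigr => S _.
by rewrite -prodr_const big_mkcond.
Qed.

End posterior.

Section contraction.
Context (R : realType).
Add Field real_field : (real_field_theory R).
Variables (g : R -> R) (gP : prior_density g).
Variables (n : nat) (f0 : R -> R) (n0 : (0 < n)%N).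

Let a (i : 'I_n) : R := f0 (design R i).
Let L : R := log_en R n.

Let L_ge1 : 1 <= L. Proof. exact: log_en_ge1. Qed.

Let lik_ge0 (Y : n.-tuple R) f : (0 <= (likelihood Y f)%:E)%E.
Proof. by rewrite lee_fin ltW// likelihood_gt0. Qed.

(** The prior integral is at least its contribution from the box next to [mu], on
which the likelihood is at least [likelihood Y f0 / v]. *)
Lemma evidence_ge (c tau v : R) m (S : {set 'I_n}) (mu : (minn m n).-tuple R)
    (Y : n.-tuple R) :
  1 <= c -> (0 < m)%N -> S \in @change_points n (minn m n) ->
  sorted <=%R mu -> 0 <= tau -> 0 < v ->
  (forall k x, tnth mu k <= x <= tnth mu k + n%:R^-1 -> x != 0 -> tau <= g x) ->
  (forall h : 'I_n -> R, (forall i, `|h i| <= n%:R^-1) ->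
     expR (- (\sum_(i < n) (step S mu (design R i) - a i + h i) *
                           (tnth Y i - a i) -
              (\sum_(i < n) (step S mu (design R i) - a i + h i) ^+ 2) / 2))
     <= v) ->
  ((expR (- (c * m%:R * L)) * (n%:R ^- minn m n *
      ((tau / n%:R ^+ 2) ^+ minn m n * (likelihood Y f0 / v))))%:E
   <= prior_integral c n g (fun f => (likelihood Y f)%:E))%E.
Proof.
move=> c1 m0 SP smu tau0 v0 gtau vP.
have lik0 := likelihood_gt0 Y f0.
have nR : 0 < n%:R :> R by rewrite ltr0n.
apply: le_trans (prior_integral_ge gP c1 n0 m0 (lik_ge0 Y)).
rewrite EFinM; apply: lee_pmul.
- by rewrite lee_fin expR_ge0.
- by rewrite lee_fin !mulr_ge0 ?exprn_ge0 ?invr_ge0 ?exprn_ge0 ?divr_ge0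
    ?exprn_ge0// ltW.
- exact: lambda_ge.
- apply: (model_integral_ge gP n0 _ SP smu _ tau0 (lik_ge0 Y) gtau).
  + exact: geq_minr.
  + by rewrite divr_ge0// ltW.
  + move=> nu nuP; rewrite lee_fin (likelihood_ratio Y (step S nu) f0).
    rewrite ler_wpM2l ?(ltW lik0)//.
    pose h (i : 'I_n) := step S nu (design R i) - step S mu (design R i).
    have hn i : `|h i| <= n%:R^-1.
      move: SP; rewrite inE => /andP[/eqP cS /forallP/(_ (Ordinal n0))/= S0].
      have bi : (block_index S i < minn m n)%N.
        by rewrite -[X in (_ < X)%N]cS block_index_lt//; apply/card_gt0P;
          exists (Ordinal n0).
      rewrite /h !step_designE -[block_index S i]/(val (Ordinal bi)).
      have := nuP (Ordinal bi); rewrite !(tnth_nth 0) => /andP[h1 h2].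
      by rewrite ger0_norm ?subr_ge0// lerBlDl.
    have := vP h hn.
    under eq_bigr do rewrite /h addrC addrA subrK.
    under [X in _ - X / 2]eq_bigr do rewrite /h addrC addrA subrK.
    rewrite expRN => vle.
    by rewrite -[leRHS]invrK lef_pV2 ?posrE ?invr_gt0 ?expR_gt0.
Qed.

(** Each of [n^-1] and [1 / 2] is at least [exp (- L)]: one factor [n^-1] comes
from the choice of the block starts, two from the side of the box. *)
Lemma oracle_mass_ge (h : R) m : 0 <= h ->
  expR (- ((4 + h) * m%:R * L)) <=
  n%:R ^- minn m n * (expR (- (h * L)) / 2 / n%:R ^+ 2) ^+ minn m n.
Proof.
move=> h0; have nR : 0 < n%:R :> R by rewrite ltr0n.
have nV : expR (- L) <= n%:R^-1.
  by rewrite expRN lef_pV2 ?posrE ?expR_gt0// natr_le_expR_log_en.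
have halfV : expR (- L) <= 2^-1.
  by apply: le_trans (expRN1_le_half R); rewrite ler_expR lerN2.
have e0 : 0 <= expR (- L) := expR_ge0 _.
rewrite -exprVn -exprMn.
apply: (@le_trans _ _ (expR (- ((4 + h) * L)) ^+ minn m n)).
  rewrite -expRM_natl ler_expR mulrN lerN2 mulrCA -[leRHS]mulrA.
  apply: ler_wpM2l; first by rewrite addr_ge0.
  by rewrite ler_wpM2r ?(le_trans _ L_ge1)// ler_nat geq_minl.
rewrite lerXn2r ?nnegrE ?expR_ge0 ?mulr_ge0 ?invr_ge0 ?expR_ge0 ?exprn_ge0//.
rewrite (_ : - _ = - (h * L) + - L + - L + - L + - L); last by real_field.
rewrite !expRD (_ : n%:R^-1 * _ =
  expR (- (h * L)) * 2^-1 * n%:R^-1 * n%:R^-1 * n%:R^-1); last first.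
  by set k : R := n%:R; real_field.
by rewrite !ler_pM ?mulr_ge0 ?expR_ge0.
Qed.

(** For [f] in the set, [|v|^2 >= C1 E]: the term [- |v|^2 / 8] that [U] leaves
aside yields the factor [exp (- C1 E / 8)]. *)
Lemma numerator_le (K c E C1 eps2 : R) (U : {set 'I_n} -> R) (Y : n.-tuple R) :
  0 <= K -> c = K + 2 -> E = n%:R * eps2 ->
  (forall m (S : {set 'I_n}) (mu : m.-tuple R), S \in @change_points n m ->
    expR (3 / 16 / 4 * (\sum_(i < n) (step S mu (design R i) - a i) *
                                     (tnth Y i - a i) -
          3 / 8 * \sum_(i < n) (step S mu (design R i) - a i) ^+ 2)) <= U S) ->
  (forall S, U S <= expR (3 / 16 / 4 * K * (#|S|%:R * L + E))) ->
  (prior_integral c n g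
     (fun f => (\1_[set f | iso f /\ (C1 * eps2 < sqloss n f f0)%R] f *
                likelihood Y f)%:E)
   <= (likelihood Y f0 * expR (K * E - C1 * E / 8) * expR (c * L))%:E)%E.
Proof.
move=> K0 cK EE UP Ugood.
have lik0 := likelihood_gt0 Y f0.
have nR : 0 < n%:R :> R by rewrite ltr0n.
apply: (prior_integral_le gP K0 cK n0); first by rewrite mulr_ge0 ?expR_ge0// ltW.
move=> m S mu SP smu.
rewrite !lee_fin indicE; apply/andP; split.
  by rewrite mulr_ge0 ?ler0n// ltW// likelihood_gt0.
have [|_] := boolP (step S mu \in _); last first.
  by rewrite mul0r !mulr_ge0 ?expR_ge0// ltW.
rewrite inE => -[_ far]; rewrite mul1r.
set X := \sum_(i < n) (step S mu (design R i) - a i) * (tnth Y i - a i).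
pose V := \sum_(i < n) (step S mu (design R i) - a i) ^+ 2.
have EV : C1 * E <= V.
  rewrite EE mulrCA -ler_pdivlMl//; exact: ltW.
have cS : #|S| = m by move: SP; rewrite inE => /andP[/eqP].
have := le_trans (UP m S mu SP) (Ugood S).
rewrite ler_expR -[leRHS]mulrA ler_pM2l ?divr_gt0// cS -/X -/V => XV.
have -> : likelihood Y (step S mu) = likelihood Y f0 * expR (X - V / 2).
  exact: likelihood_ratio.
rewrite -[leRHS]mulrA ler_wpM2l ?(ltW lik0)// -expRD ler_expR.
rewrite -/L -subr_ge0 (_ : _ - _ = (K * (m%:R * L + E) -
  (X - 3 / 8 * V)) + (V - C1 * E) / 8); last by real_field.
by rewrite addr_ge0 ?divr_ge0 ?subr_ge0.
Qed.

End contraction.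

Section posterior_bound.
Context (R : realType).
Add Field real_field : (real_field_theory R).

Lemma posterior_le1 (g : R -> R) (c : R) n (Y : n.-tuple R) (A : set (R -> R)) :
  prior_density g -> 1 <= c -> (0 < n)%N -> (posterior c g Y A <= 1)%E.
Proof.
move=> gP c1 n0; have lik0 f : 0 <= likelihood Y f by rewrite ltW// likelihood_gt0.
have num0 f : (0 <= (\1_A f * likelihood Y f)%:E)%E.
  by rewrite lee_fin indicE mulr_ge0.
apply: dive_le1; first exact: prior_integral_ge0.
apply: prior_integral_homo => // f.
by rewrite lee_fin indicE ler_piMl//; case: (_ \in _).
Qed.

Lemma posterior_ge0 (g : R -> R) (c : R) n (Y : n.-tuple R) (A : set (R -> R)) :
  prior_density g -> 1 <= c -> (0 < n)%N -> (0 <= posterior c g Y A)%E.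
Proof.
move=> gP c1 n0.
apply: mule_ge0.
  apply: prior_integral_ge0 => // f.
  by rewrite lee_fin indicE mulr_ge0// ltW// likelihood_gt0.
have : (0 <= prior_integral c n g (fun f => (likelihood Y f)%:E))%E.
  by apply: prior_integral_ge0 => // f; rewrite lee_fin ltW// likelihood_gt0.
by case: (inveP (prior_integral _ _ _ _)) => // r _; rewrite !lee_fin invr_ge0.
Qed.

Lemma integral_scale_le d (T : measurableType d) (mu : {measure set T -> \bar R})
    (f : T -> R) (r v : R) :
  measurable_fun setT f -> (forall x, 0 <= f x) -> 0 <= r ->
  (\int[mu]_x (f x)%:E <= v%:E)%E -> (\int[mu]_x (f x * r)%:E <= (v * r)%:E)%E.
Proof.
move=> mf f0 r0 fv; under eq_integral do rewrite EFinM.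
rewrite ge0_integralZr//; last 2 first.
- exact/measurable_EFinP.
- by move=> x _; rewrite lee_fin.
by rewrite EFinM lee_wpmul2r// lee_fin.
Qed.

(** The sum over the sets of block starts is [(1 + x) ^ n] with
[x = 2 exp (- 2 L) <= 1 / n]. *)
Lemma penalty_sum_le n (E : R) : (0 < n)%N ->
  \sum_(S : {set 'I_n})
    expR 1 * 2 ^+ #|S| * expR (- (2 * (#|S|%:R * log_en R n + E)))
  <= expR 2 * expR (- (2 * E)).
Proof.
move=> n0; set L := log_en R n.
pose x := 2 * expR (- (2 * L)).
rewrite (eq_bigr (fun S : {set 'I_n} =>
    expR 1 * expR (- (2 * E)) * x ^+ #|S|)) => [|S _]; last first.
  rewrite exprMn -expRM_natl.
  rewrite (_ : - (2 * (_ + E)) = - (2 * E) + #|S|%:R * - (2 * L)).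
    by rewrite expRD mulrACA.
  by set k : R := #|S|%:R; real_field.
rewrite -mulr_sumr sum_subsets.
have -> : expR 2 = expR 1 * expR 1 :> R by rewrite -expRD.
rewrite [leRHS]mulrAC; apply: ler_wpM2l; first by rewrite mulr_ge0 ?expR_ge0.
apply: (@le_trans _ _ (expR x ^+ n)).
  rewrite lerXn2r ?nnegrE ?expR_ge0 ?addr_ge0 ?mulr_ge0 ?expR_ge0//.
  by rewrite addrC expR_ge1Dx.
rewrite -expRM_natl ler_expR /x (_ : - (2 * L) = - L - L); last by real_field.
rewrite expRD !expRN.
have L1 : 1 <= L by exact: log_en_ge1.
have nL : n%:R <= expR L by exact: natr_le_expR_log_en.
have twoL : 2 <= expR L.
  by rewrite (le_trans (expR_ge1Dx 1))// ler_expR.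
have eL : 0 < expR L by exact: expR_gt0.
rewrite (_ : _ * _ = (n%:R / expR L) * (2 / expR L)); last first.
  by set k : R := n%:R; set e := (expR L)^-1; real_field.
by rewrite mulr_ile1 ?divr_ge0 ?expR_ge0// ler_pdivrMr// mul1r.
Qed.

(** [K] turns the threshold [exp (2 (|S| L + E))] on [U_S] into one for the
likelihood ratio, [D] collects the cost of the prior mass of the box next to
the best approximation, and [C1] is such that the good event leaves
[exp (3 E) exp (- 4 E)]. *)
Lemma expected_posterior_le (h K : R) (g : R -> R) (n m : nat) (f0 : R -> R)
    (c := K + 2) (D := c + 4 + h) (C1 := 8 * (4 + c + K + D))
    (E := n%:R * eps2_iso n m f0) :
  0 <= h -> 3 / 16 / 4 * K = 2 ->
  prior_density g -> (0 < n)%N -> (0 < m)%N ->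
  expR (- (h * log_en R n)) <= tau_iso n m g f0 ->
  (\int[data_law n f0]_Y
     posterior c g Y
       [set f | iso f /\ (C1 * eps2_iso n m f0 < sqloss n f f0)%R]
   <= ((3 * expR 2 + 1) * expR (- E))%:E)%E.
Proof.
move=> h0 KE gP n0 m0 tauP.
have K0 : 0 < K by rewrite -(pmulr_rgt0 K (_ : 0 < 3 / 16 / 4)) ?KE// !divr_gt0.
have c1 : 1 <= c by rewrite -lerBlDr (le_trans _ (ltW K0))// lerBlDr add0r ler1n.
have c0 : 0 < c by rewrite (lt_le_trans ltr01).
have D0 : 0 < D by rewrite ltr_wpDr// addr_gt0.
pose L := log_en R n.
have nR : 0 < n%:R :> R by rewrite ltr0n.
have L1 : 1 <= L by exact: log_en_ge1.
have mLE : m%:R * L <= E.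
  by rewrite /E [leRHS]mulrC -ler_pdivrMr// /eps2_iso le_max lexx orbT.
have LE : L <= E.
  by apply: le_trans mLE; rewrite ler_peMl ?ler1n// (le_trans _ L1).
have E0 : 0 <= E by rewrite (le_trans _ LE)// (le_trans _ L1).
have tau0 : 0 < tau_iso n m g f0 by rewrite (lt_le_trans _ tauP)// expR_gt0.
have [S [mu [SP smu muE gmu]]] := oracle_step gP n0 tau0.
pose a (i : 'I_n) : R := f0 (design R i).
pose w (i : 'I_n) : R := step S mu (design R i) - a i.
have [U UP] := step_likelihood_bounds n0 a.
have [V [mV V0 iV VP]] := inverse_likelihood_bound n0 a w.
set A := [set f | _].
pose q (S' : {set 'I_n}) := expR (- (2 * (#|S'|%:R * L + E))).
(* Markov's inequality for V and for every U S', in pointwise form. *)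
pose Phi Y := V Y * expR (- (3 * E)) + \sum_(S' : {set 'I_n}) U S' Y * q S'
              + expR (- E).
have q0 S' : 0 <= q S' by exact: expR_ge0.
have U0 S' Y : 0 <= U S' Y by have [_ + _ _] := UP S'; exact.
have sum0 Y : 0 <= \sum_(S' : {set 'I_n}) U S' Y * q S'.
  by apply: sumr_ge0 => S' _; rewrite mulr_ge0.
have bound Y : (posterior c g Y A <= (Phi Y)%:E)%E.
  have [[Vgood Ugood]|bad] := pselect (V Y <= expR (3 * E) /\
      forall S', U S' Y <= expR (2 * (#|S'|%:R * L + E))); last first.
    apply: (le_trans (posterior_le1 Y A gP c1 n0)); rewrite lee_fin /Phi.
    rewrite ler_wpDr ?expR_ge0//.
    have [Vgood|/ltW Vbad] := leP (V Y) (expR (3 * E)); last first.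
      rewrite ler_wpDr// expRN -[leLHS](@divff _ (expR (3 * E)))
        ?gt_eqF ?expR_gt0//.
      by rewrite ler_wpM2r// invr_ge0 expR_ge0.
    have [S' /negP] : exists S', ~ U S' Y <= expR (2 * (#|S'|%:R * L + E)).
      by apply/existsNP => Ugood; apply: bad.
    rewrite -ltNge => /ltW Ubad.
    rewrite ler_wpDl ?mulr_ge0 ?expR_ge0 ?(ltW (V0 _))//.
    rewrite (bigD1 S')//= ler_wpDr ?sumr_ge0// => [S'' _|].
      by rewrite mulr_ge0.
    rewrite /q expRN -[leLHS](@divff _ (expR (2 * (#|S'|%:R * L + E))))
      ?gt_eqF ?expR_gt0//.
    by rewrite ler_wpM2r// invr_ge0 expR_ge0.
  have lik0 := likelihood_gt0 Y f0.
  apply: (@le_trans _ _ (expR (- E))%:E); last first.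
    by rewrite lee_fin /Phi lerDr addr_ge0// mulr_ge0 ?expR_ge0// ltW.
  have num : (prior_integral c n g (fun f => (\1_A f * likelihood Y f)%:E) <=
      (likelihood Y f0 * expR (K * E - C1 * E / 8) * expR (c * L))%:E)%E.
    apply: (@numerator_le R g gP n f0 n0 K c E C1 _ (fun S' => U S' Y) Y
      (ltW K0) erefl erefl).
      by move=> k S' nu S'P; have [_ _ _ +] := UP S'; exact.
    by move=> S'; rewrite KE; exact: Ugood.
  have gtau k x : tnth mu k <= x <= tnth mu k + n%:R^-1 -> x != 0 ->
      expR (- (h * L)) / 2 <= g x.
    move=> xk x0; apply: le_trans (gmu _ _ xk x0).
    by rewrite ler_pM2r ?invr_gt0.
  have e2 : 0 <= expR (- (h * L)) / 2 by rewrite divr_ge0 ?expR_ge0.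
  have den := evidence_ge gP n0 c1 m0 SP smu e2 (V0 Y) gtau (VP Y).
  have den' : ((likelihood Y f0 / V Y * expR (- (D * E)))%:E <=
      prior_integral c n g (fun f => (likelihood Y f)%:E))%E.
    apply: le_trans den; rewrite lee_fin -/L.
    rewrite [leRHS](_ : _ = likelihood Y f0 / V Y * (expR (- (c * m%:R * L)) *
      (n%:R ^- minn m n *
       (expR (- (h * L)) / 2 / n%:R ^+ 2) ^+ minn m n))); last first.
      by rewrite [RHS]mulrC !mulrA.
    apply: ler_wpM2l; first by rewrite divr_ge0// ltW.
    apply: (@le_trans _ _ (expR (- (c * m%:R * L)) *
                           expR (- ((4 + h) * m%:R * L)))); last first.
      by rewrite ler_wpM2l ?expR_ge0// oracle_mass_ge.
    rewrite -expRD ler_expR (_ : _ + _ = - (D * (m%:R * L))); last first.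
      by rewrite /D; set k : R := m%:R; real_field.
    by rewrite lerN2 ler_wpM2l// ltW.
  have num0 : (0 <= prior_integral c n g (fun f => (\1_A f * likelihood Y f)%:E))%E.
    apply: prior_integral_ge0 => // f.
    by rewrite lee_fin indicE mulr_ge0// ltW// likelihood_gt0.
  have den0 : 0 < likelihood Y f0 / V Y * expR (- (D * E)).
    by rewrite mulr_gt0 ?expR_gt0// divr_gt0.
  apply: (le_trans (dive_le num0 num den' den0)); rewrite lee_fin.
  rewrite (_ : _ / _ = V Y * (expR (K * E - C1 * E / 8) * expR (c * L) *
                              expR (D * E))); last first.
    rewrite expRN; have := V0 Y; have := expR_gt0 (D * E); move: lik0.
    set p := likelihood Y f0; set v := V Y; set e := expR (D * E) => p0 e0 v0.
    by real_field.
  apply: (@le_trans _ _ (expR (3 * E) * (expR (K * E - C1 * E / 8) *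
                          expR (c * E) * expR (D * E)))).
    apply: ler_pM Vgood _; [exact: ltW|by rewrite ?mulr_ge0 ?expR_ge0|].
    rewrite ler_wpM2r ?expR_ge0// ler_wpM2l ?expR_ge0// ler_expR.
    by rewrite ler_wpM2l// ltW.
  rewrite -!expRD ler_expR (_ : _ + _ = - E)// /C1; real_field.
apply: (@le_trans _ _ (\int[gaussian a]_Y (Phi Y)%:E)%E).
  apply: ge0_le_integral_nonmeasurable => // Y; exact: posterior_ge0.
have mUq S' : measurable_fun setT (fun Y => U S' Y * q S').
  by have [mU _ _ _] := UP S'; apply: measurable_funM.
have mVq : measurable_fun setT (fun Y => V Y * expR (- (3 * E))).
  exact: measurable_funM.
have mSum : measurable_fun setT (fun Y => \sum_(S' : {set 'I_n}) U S' Y * q S').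
  exact: measurable_sum.
rewrite /Phi; under eq_integral do rewrite EFinD EFinD.
rewrite ge0_integralD//; last 2 first.
- move=> Y _; rewrite -EFinD lee_fin addr_ge0// mulr_ge0 ?expR_ge0//.
  exact: ltW.
- by apply: emeasurable_funD; exact/measurable_EFinP.
rewrite ge0_integralD//; last 4 first.
- by move=> Y _; rewrite lee_fin mulr_ge0 ?expR_ge0// ltW.
- exact/measurable_EFinP.
- by move=> Y _; rewrite lee_fin.
- exact/measurable_EFinP.
rewrite integral_gaussian_cst.
have WE : \sum_(i < n) w i ^+ 2 <= E by exact: muE.
have intV : (\int[gaussian a]_Y (V Y * expR (- (3 * E)))%:E <=
    (2 * expR 2 * expR (- E))%:E)%E.
  apply: le_trans (integral_scale_le mV _ (expR_ge0 _) iV) _ => [Y|].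
    exact: ltW.
  rewrite lee_fin -!mulrA ler_wpM2l// -!expRD ler_expR.
  rewrite -subr_ge0 (_ : _ - _ = 2 * (E - \sum_(i < n) w i ^+ 2)).
    by rewrite mulr_ge0// subr_ge0.
  by set W := \sum_(i < n) _; real_field.
have intU : (\int[gaussian a]_Y (\sum_(S' : {set 'I_n}) U S' Y * q S')%:E <=
    (expR 2 * expR (- E))%:E)%E.
  under eq_integral do rewrite -sumEFin.
  rewrite ge0_integral_sum//; last 2 first.
  - by move=> S'; exact/measurable_EFinP.
  - by move=> S' Y _; rewrite lee_fin mulr_ge0.
  apply: (@le_trans _ _ (\sum_(S' : {set 'I_n})
      (expR 1 * 2 ^+ #|S'| * q S')%:E)%E).
    apply: lee_sum => S' _; have [mU _ iU _] := UP S'.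
    exact: integral_scale_le.
  rewrite sumEFin lee_fin; apply: (le_trans (penalty_sum_le E n0)).
  by rewrite ler_wpM2l ?expR_ge0// ler_expR lerN2 ler_peMl// ler1n.
apply: (le_trans (leeD (leeD intV intU) (lexx _))).
rewrite -!EFinD lee_fin -subr_ge0 (_ : _ - _ = 0)//.
by real_field.
Qed.

End posterior_bound.

Theorem theorem3p8 (R : realType) (eta : R) (eta_gt0 : 0 < eta)
    (eta_lt : eta < 1 / 2) :
  exists c C1 C2 : R, [/\ 0 < c, 0 < C1, 0 < C2 &
    forall (g : R -> R) (n m : nat) (f0 : R -> R),
      prior_density g -> (0 < n)%N -> (0 < m)%N ->
      expR (- (log_en R n / (2 * eta))) <= tau_iso n m g f0 ->
      (\int[data_law n f0]_Y
         posterior c g Y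
           [set f | iso f /\ (C1 * eps2_iso n m f0 < sqloss n f f0)%R]
       <= (C2 * expR (- (n%:R * eps2_iso n m f0 / C2)))%:E)%E].
Proof.
pose K : R := 2 / (3 / 16 / 4); pose c : R := K + 2; pose h : R := (2 * eta)^-1.
pose C2 : R := 3 * expR 2 + 1.
have K0 : 0 < K by rewrite !divr_gt0.
have c0 : 0 < c by rewrite addr_gt0.
have h0 : 0 < h by rewrite invr_gt0 mulr_gt0.
have C21 : 1 <= C2 by rewrite lerDr mulr_ge0// expR_ge0.
exists c, (8 * (4 + c + K + (c + 4 + h))), C2; split => //.
- by rewrite mulr_gt0 ?addr_gt0.
- exact: lt_le_trans C21.
move=> g n m f0 gP n0 m0 tauP.
have KE : 3 / 16 / 4 * K = 2.
  by rewrite /K mulrCA divff ?mulr1// gt_eqF// !divr_gt0.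
have tauP' : expR (- (h * log_en R n)) <= tau_iso n m g f0 by rewrite mulrC.
apply: (le_trans (expected_posterior_le (ltW h0) KE gP n0 m0 tauP')).
rewrite lee_fin ler_wpM2l ?(le_trans ler01)// ler_expR lerN2.
rewrite ler_pdivrMr ?(lt_le_trans ltr01)// ler_peMr// mulr_ge0//.
by rewrite le_max orbC divr_ge0// mulr_ge0// (le_trans ler01)// log_en_ge1.
Qed.
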